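(* Let $f(z)=z+\sum_{n=2}^\infty a_nz^n$ belong to $\mathcal{S}^*_B$. Then $|H_{3,1}(f)|\le\dfrac19$, and this inequality is sharp.
   Context: Let $\mathbb{D}=\{z\in\mathbb{C}:|z|<1\}$ and let $\mathcal{A}$ be the class of analytic functions $f$ in $\mathbb{D}$ with $f(0)=0$, $f'(0)=1$, so $f(z)=z+\sum_{n\ge2}a_nz^n$. For analytic $g,h$ in $\mathbb{D}$, $g\prec h$ (subordination) means $g(z)=h(w(z))$ for some analytic $w:\mathbb{D}\to\mathbb{D}$ with $w(0)=0$. The class is $$\mathcal{S}^*_B=\left\{f\in\mathcal{A}:\frac{zf'(z)}{f(z)}\prec\frac{1}{1-\log(1+z)},\ z\in\mathbb{D}\right\},$$ with $\log$ the principal branch. The third-order Hankel determinant is $$H_{3,1}(f)=\begin{vmatrix} 1 & a_2 & a_3 \\ a_2 & a_3 & a_4 \\ a_3 & a_4 & a_5 \end{vmatrix}=2a_2a_3a_4+a_3a_5-a_2^2a_5-a_3^3-a_4^2.$$ ''Sharp'' means that equality holds for some function in $\mathcal{S}^*_B$. *)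

(* Defs.v *)
From Stdlib Require Import Reals.
From Coquelicot Require Import Coquelicot.
Open Scope C_scope.

Definition unit_disc (z : C) : Prop := (Cmod z < 1)%R.

(* Analytic in the disc = complex differentiable at each of its points; over
   [C_AbsRing], [ex_derive] is complex differentiability. *)
Definition analytic_disc (f : C -> C) : Prop :=
  forall z : C, unit_disc z -> ex_derive (K := C_AbsRing) f z.

Definition class_A (f : C -> C) : Prop :=
  analytic_disc f /\ f 0 = 0 /\ C_derive f 0 = 1.

Definition taylor_disc (f : C -> C) (a : nat -> C) : Prop :=
  forall z : C, unit_disc z -> is_pseries (K := C_AbsRing) a z (f z).

(* Principal argument, in (-PI, PI]; the value at 0 is a dummy. *)
Definition Carg (z : C) : R :=
  if Rle_dec 0 (Im z) then acos (Re z / Cmod z) else (- acos (Re z / Cmod z))%R.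

Definition Clog (z : C) : C := (ln (Cmod z), Carg z).

Definition subordinate (g h : C -> C) : Prop :=
  exists w : C -> C,
    analytic_disc w /\ w 0 = 0 /\
    (forall z : C, unit_disc z -> unit_disc (w z)) /\
    (forall z : C, unit_disc z -> g z = h (w z)).

(* z f'(z) / f(z), with its removable singularity at 0 filled in:
   f(z) / z tends to f'(0) = 1 when f is in [class_A]. *)
Definition log_quotient (f : C -> C) (z : C) : C :=
  if Ceq_dec z 0 then 1 else z * C_derive f z / f z.

(* The nonvanishing of f off 0 says that z f'(z) / f(z) is defined throughout
   the disc, so that division by zero never occurs in [log_quotient]. *)
Definition S_star_B (f : C -> C) : Prop :=
  class_A f /\
  (forall z : C, unit_disc z -> z <> 0 -> f z <> 0) /\
  subordinate (log_quotient f) (fun z => 1 / (1 - Clog (1 + z))).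

Definition det3 (x11 x12 x13 x21 x22 x23 x31 x32 x33 : C) : C :=
  x11 * (x22 * x33 - x23 * x32)
  - x12 * (x21 * x33 - x23 * x31)
  + x13 * (x21 * x32 - x22 * x31).

Definition H31 (a : nat -> C) : C :=
  det3 1       (a 2%nat) (a 3%nat)
       (a 2%nat) (a 3%nat) (a 4%nat)
       (a 3%nat) (a 4%nat) (a 5%nat).

Lemma H31_expand (a : nat -> C) :
  H31 a = 2 * a 2%nat * a 3%nat * a 4%nat + a 3%nat * a 5%nat
          - a 2%nat ^ 2 * a 5%nat - a 3%nat ^ 3 - a 4%nat ^ 2.
Proof. unfold H31, det3; ring. Qed.

(* Main.v *)
(* Let [w] be the Schwarz function with [z f'/f = 1 / (1 - log (1 + w))] and [w = c1 z + c2 z^2 + ...].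
   The coefficients [a2, ..., a5], hence [H31], are polynomials in [c1, ..., c4], and in

     H31 = 37/10368 c1^6 - 17/1728 c1^4 c2 + c1^3 c3 / 432 - c1^2 c2^2 / 144 - c1^2 c4 / 16
           + 5/72 c1 c2 c3 + c2 c4 / 8 - c3^2 / 9

   all coefficients are so small that Bessel's inequality [|c1|^2 + |c2|^2 + |c3|^2 + |c4|^2 <= 1] for
   the bounded function [w] and the triangle inequality already give [1/9].  Bessel's inequality comes
   from the constancy in the radius of circle means of holomorphic functions; the continuity of [w']
   that this needs is read off [log (1 + w) = 1 - f / (z f')].

   Equality holds for [w = z^3].  Then [f = z G(z^3)] with [(1 - log (1 + u)) (G + 3 u G') = G], and after
   multiplication by [1 + u] the recursion for the coefficients of [G] keeps them bounded by 1, so that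
   the series converges in the whole disc. *)
Require Import Defs.
From Stdlib Require Import Reals Lra Lia Psatz Arith.
From Coquelicot Require Import Coquelicot.
Open Scope C_scope.

(** * Complex derivatives *)

(** The function [w] is given only as complex differentiable at each point, and the argument
    proceeds without Cauchy's integral theory, so neither continuity of [w'] nor a Taylor expansion
    of [w] is at hand. By contrast [f] comes with its power series, which may be differentiated
    termwise as often as needed. Everything about [w] is therefore extracted from [f]: the numbers
    [c1, ..., c4] are obtained by solving for them in terms of [a2, ..., a5], and only then is
    [w - (c1 z + ... + c4 z^4)] shown to be O(z^5). Accordingly Bessel's inequality is proved for a
    function with such an expansion at 0, not for the sum of a series. The final estimate is tight:
    the weights that |c2|^2 and |c3|^2 receive both reach 1/9 exactly, and the term in c3^2 alone
    makes [w = z^3] the candidate for equality. On the extremal side, membership in the class also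
    demands that [f] have no zero off 0. This comes from the linear differential equation for [G],
    by a Gronwall argument along segments from 0. *)

Notation cderiv := (@is_derive C_AbsRing C_NormedModule).

Lemma cderiv_eps (f : C -> C) (z l : C) :
  cderiv f z l <->
  forall eps : R, (0 < eps)%R -> exists d : R, (0 < d)%R /\
    forall y : C, (Cmod (y - z) < d)%R ->
      (Cmod (f y - f z - (y - z) * l) <= eps * Cmod (y - z))%R.
Proof.
  split.
  - intros [_ H] eps He.
    destruct (H z (fun P HP => HP) (mkposreal eps He)) as [d Hd].
    exists d; split; [apply cond_pos|].
    intros y Hy; exact (Hd y Hy).
  - intros H; split.
    + apply (is_linear_scal_l (K := C_AbsRing) (V := C_NormedModule) l).
    + intros x Hx eps.
      assert (z = x) as <-.
      { apply (is_filter_lim_locally_unique (K := C_AbsRing) (V := AbsRing_NormedModule C_AbsRing) z x Hx). }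
      destruct (H eps (cond_pos eps)) as [d [Hd Hy]].
      exists (mkposreal d Hd); intros y Hyd; exact (Hy y Hyd).
Qed.

(* [C_NormedModule] and [AbsRing_NormedModule C_AbsRing] carry the same norm but
   different (equivalent) uniform structures, hence are not convertible. *)
Lemma cderiv_AbsRing (f : C -> C) (z l : C) :
  @is_derive C_AbsRing (AbsRing_NormedModule C_AbsRing) f z l <-> cderiv f z l.
Proof.
  split; intros [_ H]; split.
  - apply (is_linear_scal_l (K := C_AbsRing) (V := C_NormedModule) l).
  - exact H.
  - apply (is_linear_scal_l (K := C_AbsRing) (V := AbsRing_NormedModule C_AbsRing) l).
  - exact H.
Qed.

Lemma cderiv_ext (f g : C -> C) (z l : C) :
  (forall y, f y = g y) -> cderiv f z l -> cderiv g z l.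
Proof. intros H; apply is_derive_ext; exact H. Qed.

Lemma cderiv_ext_near (f g : C -> C) (z l : C) (r : R) : (0 < r)%R ->
  (forall y, (Cmod (y - z) < r)%R -> f y = g y) -> cderiv f z l -> cderiv g z l.
Proof.
  intros Hr H; apply is_derive_ext_loc.
  exists (mkposreal r Hr); intros y Hy; apply H; exact Hy.
Qed.

Lemma cderiv_const (c z : C) : cderiv (fun _ => c) z (RtoC 0).
Proof. exact (is_derive_const (K := C_AbsRing) (V := C_NormedModule) c z). Qed.

Lemma cderiv_id (z : C) : cderiv (fun y => y) z (RtoC 1).
Proof. apply cderiv_AbsRing, (is_derive_id (K := C_AbsRing) z). Qed.

Lemma cderiv_plus (f g : C -> C) (z a b : C) :
  cderiv f z a -> cderiv g z b -> cderiv (fun y => f y + g y) z (a + b).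
Proof. exact (is_derive_plus (K := C_AbsRing) (V := C_NormedModule) f g z a b). Qed.

Lemma cderiv_mult (f g : C -> C) (z a b : C) :
  cderiv f z a -> cderiv g z b ->
  cderiv (fun y => f y * g y) z (a * g z + f z * b).
Proof.
  intros Hf Hg.
  apply cderiv_AbsRing in Hf, Hg; apply cderiv_AbsRing.
  apply (is_derive_mult (K := C_AbsRing) f g z a b Hf Hg).
  intros; apply Cmult_comm.
Qed.

Lemma cderiv_comp (f g : C -> C) (z a b : C) :
  cderiv f (g z) a -> cderiv g z b -> cderiv (fun y => f (g y)) z (b * a).
Proof.
  intros Hf Hg. apply cderiv_AbsRing in Hg.
  exact (is_derive_comp (K := C_AbsRing) (V := C_NormedModule) f g z a b Hf Hg).
Qed.

(** Stated with [Cmod] so as not to depend on either uniform structure of C. The [AbsRing] structure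
    is entered only to borrow the algebra of continuous functions. *)
Definition ccont (f : C -> C) (z : C) : Prop :=
  forall eps : R, (0 < eps)%R -> exists d : R, (0 < d)%R /\
    forall y : C, (Cmod (y - z) < d)%R -> (Cmod (f y - f z) < eps)%R.

Lemma ccont_continuous (f : C -> C) (z : C) :
  ccont f z <-> continuous (T := AbsRing_UniformSpace C_AbsRing) (U := AbsRing_UniformSpace C_AbsRing) f z.
Proof.
  split.
  - intros H; apply filterlim_locally; intros eps.
    destruct (H eps (cond_pos eps)) as [d [Hd Hy]].
    exists (mkposreal d Hd); intros y Hyd; exact (Hy y Hyd).
  - intros H eps He.
    assert (H' := proj1 (filterlim_locally _ _) H (mkposreal eps He)).
    destruct H' as [d Hd]. exists d; split; [apply cond_pos|].
    intros y Hy; exact (Hd y Hy).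
Qed.

Lemma cderiv_ccont (f : C -> C) (z l : C) : cderiv f z l -> ccont f z.
Proof.
  intros H; apply ccont_continuous.
  apply (ex_derive_continuous (K := C_AbsRing) (V := AbsRing_NormedModule C_AbsRing)).
  exists l; apply cderiv_AbsRing; exact H.
Qed.

Lemma ccont_plus (f g : C -> C) (z : C) :
  ccont f z -> ccont g z -> ccont (fun y => f y + g y) z.
Proof.
  rewrite !ccont_continuous; intros Hf Hg.
  exact (continuous_plus (U := AbsRing_UniformSpace C_AbsRing) (K := C_AbsRing)
           (V := AbsRing_NormedModule C_AbsRing) f g z Hf Hg).
Qed.

Lemma ccont_minus (f g : C -> C) (z : C) :
  ccont f z -> ccont g z -> ccont (fun y => f y - g y) z.
Proof.
  rewrite !ccont_continuous; intros Hf Hg.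
  exact (continuous_minus (U := AbsRing_UniformSpace C_AbsRing) (K := C_AbsRing)
           (V := AbsRing_NormedModule C_AbsRing) f g z Hf Hg).
Qed.

Lemma ccont_mult (f g : C -> C) (z : C) :
  ccont f z -> ccont g z -> ccont (fun y => f y * g y) z.
Proof.
  rewrite !ccont_continuous; intros Hf Hg.
  exact (continuous_mult (U := AbsRing_UniformSpace C_AbsRing) (K := C_AbsRing) f g z Hf Hg).
Qed.

Lemma ccont_const (c z : C) : ccont (fun _ => c) z.
Proof. apply (cderiv_ccont _ _ _ (cderiv_const c z)). Qed.

Lemma ccont_id (z : C) : ccont (fun y => y) z.
Proof. apply (cderiv_ccont _ _ _ (cderiv_id z)). Qed.

Lemma Cmod_minus_sym (x y : C) : Cmod (x - y) = Cmod (y - x).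
Proof. rewrite <- Cmod_opp; f_equal; ring. Qed.

Lemma Cmod_triangle_rev (x y : C) : (Cmod x - Cmod y <= Cmod (x - y))%R.
Proof.
  assert (H := Cmod_triangle (x - y) y).
  replace (x - y + y) with x in H by ring. lra.
Qed.

(* On [|y - z| < |z|/2] we have [|1/y - 1/z + (y - z)/z^2| = |y - z|^2 / (|y| |z|^2)]. *)
Lemma cderiv_inv_id (z : C) : z <> 0 -> cderiv Cinv z (Copp (Cinv (z * z))).
Proof.
  intros Hz; apply cderiv_eps; intros eps He.
  assert (Hm := proj1 (Cmod_gt_0 z) Hz).
  set (m := Cmod z) in *.
  exists (Rmin (m / 2) (eps * (m * m * m) / 2)); split.
  { apply Rmin_glb_lt; [lra|]. apply Rdiv_lt_0_compat; [|lra].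
    repeat apply Rmult_lt_0_compat; assumption. }
  intros y Hy.
  assert (H1 : (Cmod (y - z) < m / 2)%R) by (eapply Rlt_le_trans; [apply Hy|apply Rmin_l]).
  assert (H2 : (Cmod (y - z) < eps * (m * m * m) / 2)%R) by (eapply Rlt_le_trans; [apply Hy|apply Rmin_r]).
  assert (H3 := Cmod_triangle_rev z y). rewrite Cmod_minus_sym in H3. fold m in H3.
  assert (Hy2 : (m / 2 < Cmod y)%R) by lra.
  assert (Hy0 : y <> 0) by (apply Cmod_gt_0; lra).
  replace (/ y - / z - (y - z) * - / (z * z)) with ((y - z) * ((y - z) * / (y * (z * z)))) by (field; auto).
  rewrite Cmod_mult, Rmult_comm. apply Rmult_le_compat_r; [apply Cmod_ge_0|].
  rewrite Cmod_mult, Cmod_inv by (repeat apply Cmult_neq_0; assumption).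
  rewrite !Cmod_mult. fold m.
  assert (Hp : (0 < Cmod y * (m * m))%R) by (repeat apply Rmult_lt_0_compat; lra).
  apply Rmult_le_reg_r with (1 := Hp).
  rewrite Rmult_assoc, Rinv_l, Rmult_1_r by lra.
  apply Rle_trans with (eps * (m * m * m) / 2)%R; [lra|].
  replace (eps * (m * m * m) / 2)%R with (eps * ((m / 2) * (m * m)))%R by field.
  apply Rmult_le_compat_l; [lra|]. apply Rmult_le_compat_r; [nra|lra].
Qed.

Lemma cderiv_inv (f : C -> C) (z l : C) :
  f z <> 0 -> cderiv f z l -> cderiv (fun y => / f y) z (l * - / (f z * f z)).
Proof.
  intros Hz H. apply (cderiv_comp Cinv f); [|exact H]. apply cderiv_inv_id; exact Hz.
Qed.

Lemma ccont_inv (f : C -> C) (z : C) :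
  f z <> 0 -> ccont f z -> ccont (fun y => / f y) z.
Proof.
  intros Hz H. rewrite ccont_continuous in *.
  apply (continuous_comp (U := AbsRing_UniformSpace C_AbsRing) (V := AbsRing_UniformSpace C_AbsRing) (W := AbsRing_UniformSpace C_AbsRing) f Cinv); [exact H|].
  apply ccont_continuous. apply (cderiv_ccont _ _ _ (cderiv_inv_id _ Hz)).
Qed.

Lemma cderiv_unique (f : C -> C) (z a b : C) : cderiv f z a -> cderiv f z b -> a = b.
Proof.
  intros Ha Hb. rewrite <- (is_C_derive_unique f z a Ha). apply is_C_derive_unique; exact Hb.
Qed.

Lemma cderiv_pow (n : nat) (z : C) : cderiv (fun y => y ^ S n) z (INR (S n) * z ^ n).
Proof.
  induction n as [|n IH].
  - apply (cderiv_ext (fun y => y)); [intros; simpl; ring|].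
    replace (INR 1 * z ^ 0) with (RtoC 1) by (simpl; ring). apply cderiv_id.
  - apply (cderiv_ext (fun y => y * y ^ S n)); [intros; simpl; ring|].
    replace (INR (S (S n)) * z ^ S n) with (1 * z ^ S n + z * (INR (S n) * z ^ n)).
    2:{ rewrite (S_INR (S n)), RtoC_plus. simpl. ring. }
    apply cderiv_mult; [apply cderiv_id|exact IH].
Qed.

(** * Complex series and power series *)

Notation cseries := (@is_series C_AbsRing C_NormedModule).
Notation cpseries := (@is_pseries C_AbsRing C_NormedModule).
Notation csum := (@sum_n (NormedModule.AbelianMonoid C_AbsRing C_NormedModule)).

Lemma cseries_eps (u : nat -> C) (l : C) :
  cseries u l <->
  forall eps : R, (0 < eps)%R -> exists N : nat,
    forall n, (N <= n)%nat -> (Cmod (csum u n - l) < eps)%R.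
Proof.
  split.
  - intros H eps He.
    exact (proj1 (filterlim_locally_ball_norm (K := C_AbsRing) (U := C_NormedModule) _ l) H (mkposreal eps He)).
  - intros H. apply (filterlim_locally_ball_norm (K := C_AbsRing) (U := C_NormedModule)).
    intros eps. exact (H eps (cond_pos eps)).
Qed.

Lemma Re_csum (u : nat -> C) (n : nat) : Re (csum u n) = sum_n (fun k => Re (u k)) n.
Proof.
  induction n as [|n IH]; [rewrite !sum_O; reflexivity|].
  rewrite !sum_Sn, <- IH. reflexivity.
Qed.

Lemma Im_csum (u : nat -> C) (n : nat) : Im (csum u n) = sum_n (fun k => Im (u k)) n.
Proof.
  induction n as [|n IH]; [rewrite !sum_O; reflexivity|].
  rewrite !sum_Sn, <- IH. reflexivity.
Qed.

Lemma Rseries_eps (u : nat -> R) (l : R) :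
  is_series u l <->
  forall eps : R, (0 < eps)%R -> exists N : nat,
    forall n, (N <= n)%nat -> (Rabs (sum_n u n - l) < eps)%R.
Proof.
  split.
  - intros H eps He. exact (proj1 (filterlim_locally _ l) H (mkposreal eps He)).
  - intros H. apply filterlim_locally. intros eps. exact (H eps (cond_pos eps)).
Qed.

Lemma im_le_Cmod (c : C) : (Rabs (Im c) <= Cmod c)%R.
Proof. eapply Rle_trans; [apply Rmax_r|apply Rmax_Cmod]. Qed.

Lemma Cmod_le_ReIm (c : C) : (Cmod c <= Rabs (Re c) + Rabs (Im c))%R.
Proof.
  replace c with (RtoC (Re c) + Ci * RtoC (Im c)) at 1 by (destruct c; unfold RtoC, Ci, Cplus, Cmult, Re, Im; simpl; f_equal; ring).
  eapply Rle_trans; [apply Cmod_triangle|].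
  rewrite Cmod_mult, !Cmod_R, Cmod_Ci. lra.
Qed.

(** Opens the way to real series, from which uniqueness of the sum and the Cauchy product are
    inherited. *)
Lemma cseries_ReIm (u : nat -> C) (l : C) :
  cseries u l <->
  is_series (fun k => Re (u k)) (Re l) /\ is_series (fun k => Im (u k)) (Im l).
Proof.
  rewrite cseries_eps, !Rseries_eps. split.
  - intros H; split; intros eps He; destruct (H eps He) as [N HN]; exists N; intros n Hn;
      (eapply Rle_lt_trans; [|apply (HN n Hn)]).
    + rewrite <- Re_csum. apply (re_le_Cmod (csum u n - l)).
    + rewrite <- Im_csum. apply (im_le_Cmod (csum u n - l)).
  - intros [H1 H2] eps He.
    destruct (H1 (eps / 2)%R) as [N1 HN1]; [lra|].
    destruct (H2 (eps / 2)%R) as [N2 HN2]; [lra|].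
    exists (max N1 N2); intros n Hn.
    assert (h1 := HN1 n ltac:(lia)). assert (h2 := HN2 n ltac:(lia)).
    rewrite <- Re_csum in h1. rewrite <- Im_csum in h2.
    eapply Rle_lt_trans; [apply Cmod_le_ReIm|].
    change (Re (csum u n - l)) with (Re (csum u n) - Re l)%R.
    change (Im (csum u n - l)) with (Im (csum u n) - Im l)%R. lra.
Qed.

Lemma cseries_ext (u v : nat -> C) (l : C) :
  (forall n, u n = v n) -> cseries u l -> cseries v l.
Proof. apply is_series_ext. Qed.

Lemma cseries_unique (u : nat -> C) (l m : C) : cseries u l -> cseries u m -> l = m.
Proof.
  intros H1 H2. apply cseries_ReIm in H1, H2. destruct H1 as [a b], H2 as [c d].
  apply injective_projections; [change (Re l = Re m)|change (Im l = Im m)].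
  - rewrite <- (is_series_unique _ _ a). apply is_series_unique, c.
  - rewrite <- (is_series_unique _ _ b). apply is_series_unique, d.
Qed.

Lemma cseries_plus (u v : nat -> C) (l m : C) :
  cseries u l -> cseries v m -> cseries (fun n => u n + v n) (l + m).
Proof. exact (is_series_plus u v l m). Qed.

Lemma cseries_minus (u v : nat -> C) (l m : C) :
  cseries u l -> cseries v m -> cseries (fun n => u n - v n) (l - m).
Proof. exact (is_series_minus u v l m). Qed.

Lemma cseries_scal (c : C) (u : nat -> C) (l : C) :
  cseries u l -> cseries (fun n => c * u n) (c * l).
Proof. exact (is_series_scal (K := C_AbsRing) (V := C_NormedModule) c u l). Qed.

Lemma cseries_ex (u : nat -> C) (v : nat -> R) :
  (forall n, (Cmod (u n) <= v n)%R) -> ex_series v -> exists l, cseries u l.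
Proof.
  intros H Hv.
  destruct (ex_series_le (K := C_AbsRing) (V := C_CompleteNormedModule) u v H Hv) as [l Hl].
  exists l; exact Hl.
Qed.

Lemma Cmod_csum_le (u : nat -> C) (n : nat) :
  (Cmod (csum u n) <= sum_n (fun k => Cmod (u k)) n)%R.
Proof. exact (norm_sum_n_m u 0 n). Qed.

Lemma cseries_Cmod_le (u : nat -> C) (v : nat -> R) (l : C) (m : R) :
  (forall n, (Cmod (u n) <= v n)%R) -> cseries u l -> is_series v m -> (Cmod l <= m)%R.
Proof.
  intros H Hu Hv. apply le_epsilon; intros eps He.
  destruct (proj1 (cseries_eps u l) Hu (eps / 2)%R ltac:(lra)) as [N1 H1].
  destruct (proj1 (Rseries_eps v m) Hv (eps / 2)%R ltac:(lra)) as [N2 H2].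
  set (n := max N1 N2).
  assert (h1 := H1 n ltac:(lia)). assert (h2 := H2 n ltac:(lia)).
  apply Rabs_def2 in h2.
  assert (h3 : (Cmod (csum u n) <= sum_n v n)%R).
  { eapply Rle_trans; [apply Cmod_csum_le|]. apply sum_n_m_le. exact H. }
  assert (h4 := Cmod_triangle_rev l (csum u n)). rewrite Cmod_minus_sym in h4. lra.
Qed.

Lemma sum_n_Rminus (u v : nat -> R) (n : nat) :
  sum_n (fun k => u k - v k)%R n = (sum_n u n - sum_n v n)%R.
Proof.
  induction n as [|n IH]; [rewrite !sum_O; reflexivity|].
  rewrite !sum_Sn, IH; unfold plus; simpl; ring.
Qed.

(** Four real Cauchy products, recombined as in the multiplication of complex numbers. Their
    absolute convergence follows from |Re|, |Im| <= [Cmod]. *)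
Lemma cseries_mult (u v : nat -> C) (l m : C) :
  cseries u l -> cseries v m ->
  ex_series (fun n => Cmod (u n)) -> ex_series (fun n => Cmod (v n)) ->
  cseries (fun n => csum (fun k => u k * v (n - k)%nat) n) (l * m).
Proof.
  intros Hu Hv Eu Ev.
  apply cseries_ReIm in Hu, Hv. destruct Hu as [u1 u2], Hv as [v1 v2].
  assert (dom : forall w : nat -> C, ex_series (fun n => Cmod (w n)) ->
     ex_series (fun n => Rabs (Re (w n))) /\ ex_series (fun n => Rabs (Im (w n)))).
  { intros w Hw; split; (eapply (ex_series_le (K := R_AbsRing) (V := R_CompleteNormedModule)); [|exact Hw]); intros n;
      unfold norm; simpl; unfold abs; simpl; rewrite Rabs_Rabsolu; [apply re_le_Cmod|apply im_le_Cmod]. }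
  destruct (dom u Eu) as [eu1 eu2]. destruct (dom v Ev) as [ev1 ev2].
  assert (h11 := is_series_mult _ _ _ _ u1 v1 eu1 ev1).
  assert (h22 := is_series_mult _ _ _ _ u2 v2 eu2 ev2).
  assert (h12 := is_series_mult _ _ _ _ u1 v2 eu1 ev2).
  assert (h21 := is_series_mult _ _ _ _ u2 v1 eu2 ev1).
  apply cseries_ReIm; split.
  - eapply is_series_ext; [|exact (is_series_minus _ _ _ _ h11 h22)].
    intros n. rewrite Re_csum. rewrite <- !sum_n_Reals.
    symmetry.
    match goal with |- _ = plus ?x (opp ?y) => change (plus x (opp y)) with (x - y)%R end.
    rewrite <- sum_n_Rminus. apply sum_n_ext; intros k; reflexivity.
  - eapply is_series_ext; [|exact (is_series_plus _ _ _ _ h12 h21)].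
    intros n. rewrite Im_csum. rewrite <- !sum_n_Reals.
    rewrite <- (sum_n_plus (G := R_AbelianMonoid)).
    apply sum_n_ext; intros k; reflexivity.
Qed.

(** * Power series in the unit disc *)

Lemma cpseries_cseries (a : nat -> C) (z l : C) :
  cpseries a z l <-> cseries (fun n => a n * z ^ n) l.
Proof.
  assert (H : forall n, pow_n (K := C_AbsRing) z n = z ^ n).
  { induction n as [|n IH]; [reflexivity|]. simpl. rewrite IH. reflexivity. }
  split; apply cseries_ext; intros n; [symmetry|]; rewrite Cmult_comm, <- H; reflexivity.
Qed.

Lemma cseries_incr (u : nat -> C) (l : C) :
  cseries u l -> cseries (fun n => u (S n)) (l - u 0%nat).
Proof.
  intros H. apply is_series_incr_1.
  change (cseries u (l - u 0%nat + u 0%nat)).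
  replace (l - u 0%nat + u 0%nat) with l by ring. exact H.
Qed.

(** Says that the radius of convergence is at least 1. Boundedness of the terms is the convenient
    form: it is immediate from convergence, and it returns absolute convergence at every smaller
    radius. *)
Definition tame (a : nat -> C) : Prop :=
  forall r : R, (0 < r < 1)%R -> exists M : R, forall n, (Cmod (a n) * r ^ n <= M)%R.

Lemma cseries_bounded (u : nat -> C) (l : C) :
  cseries u l -> exists M : R, forall n, (Cmod (u n) <= M)%R.
Proof.
  intros H. destruct (proj1 (cseries_eps u l) H 1%R Rlt_0_1) as [N HN].
  assert (HB : exists B : R, forall n, (n <= N)%nat -> (Cmod (u n) <= B)%R).
  { clear HN. induction N as [|N [B HB]].
    - exists (Cmod (u 0%nat)); intros n Hn. replace n with 0%nat by lia. lra.
    - exists (Rmax B (Cmod (u (S N)))); intros n Hn.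
      destruct (Nat.eq_dec n (S N)) as [->|]; [apply Rmax_r|].
      eapply Rle_trans; [apply HB; lia|apply Rmax_l]. }
  (* Beyond [N] a term is the difference of two partial sums, each within 1 of [l], hence the 2. *)
  destruct HB as [B HB]. exists (Rmax B 2); intros n.
  destruct (Nat.le_gt_cases n N) as [Hn|Hn].
  { eapply Rle_trans; [apply HB, Hn|apply Rmax_l]. }
  destruct n as [|n]; [lia|].
  eapply Rle_trans; [|apply Rmax_r].
  assert (h1 := HN n ltac:(lia)). assert (h2 := HN (S n) ltac:(lia)).
  rewrite sum_Sn in h2. change (plus ?x ?y) with (x + y) in h2.
  replace (u (S n)) with ((csum u n + u (S n) - l) - (csum u n - l)) by ring.
  eapply Rle_trans; [apply Cmod_triangle|]. rewrite Cmod_opp. lra.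
Qed.

Lemma taylor_disc_tame (f : C -> C) (a : nat -> C) : taylor_disc f a -> tame a.
Proof.
  intros H r Hr.
  assert (Hd : unit_disc r) by (unfold unit_disc; rewrite Cmod_R, Rabs_pos_eq; lra).
  specialize (H r Hd). apply cpseries_cseries, cseries_bounded in H. destruct H as [M HM].
  exists M; intros n. specialize (HM n).
  rewrite Cmod_mult, Cmod_pow, Cmod_R, Rabs_pos_eq in HM by lra. exact HM.
Qed.

(** Boundedness at the radius [s] midway between [r] and 1 dominates the terms at [r] by a geometric
    series of ratio r/s. *)
Lemma tame_ex_series (a : nat -> C) (r : R) :
  tame a -> (0 <= r < 1)%R -> ex_series (fun n => Cmod (a n) * r ^ n)%R.
Proof.
  intros Ha Hr. set (s := ((1 + r) / 2)%R).
  destruct (Ha s) as [M HM]; [unfold s; lra|].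
  assert (Hs : (0 < s)%R) by (unfold s; lra).
  apply (ex_series_le (K := R_AbsRing) (V := R_CompleteNormedModule)) with (fun n => M * (r / s) ^ n)%R.
  - intros n. change (Rabs (Cmod (a n) * r ^ n) <= M * (r / s) ^ n)%R.
    rewrite Rabs_pos_eq by (apply Rmult_le_pos; [apply Cmod_ge_0|apply pow_le; lra]).
    replace (Cmod (a n) * r ^ n)%R with (Cmod (a n) * s ^ n * (r / s) ^ n)%R.
    2:{ rewrite Rmult_assoc, <- Rpow_mult_distr. do 2 f_equal. field; lra. }
    apply Rmult_le_compat_r; [|apply HM].
    apply pow_le, Rdiv_le_0_compat; lra.
  - apply (ex_series_scal (K := R_AbsRing) (V := R_NormedModule) M).
    apply ex_series_geom. rewrite Rabs_pos_eq by (apply Rdiv_le_0_compat; lra).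
    apply Rmult_lt_reg_r with s; [lra|]. unfold Rdiv. rewrite Rmult_assoc, Rinv_l by lra. unfold s; lra.
Qed.

Lemma tame_sum (a : nat -> C) (z : C) :
  tame a -> unit_disc z -> exists l, cpseries a z l.
Proof.
  intros Ha Hz.
  destruct (cseries_ex (fun n => a n * z ^ n) (fun n => Cmod (a n) * Cmod z ^ n)%R) as [l Hl].
  - intros n. rewrite Cmod_mult, Cmod_pow. lra.
  - apply tame_ex_series; [exact Ha|]. split; [apply Cmod_ge_0|exact Hz].
  - exists l. apply cpseries_cseries, Hl.
Qed.

(** Each of the n + 1 summands of 1 + p + ... + p^n is at least p^n. The use is that (n + 1) p^n is
    bounded by 1/(1 - p) uniformly in n. *)
Lemma succ_mult_pow_le (p : R) (n : nat) :
  (0 <= p <= 1)%R -> (INR (S n) * p ^ n * (1 - p) <= 1 - p ^ S n)%R.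
Proof.
  intros Hp. induction n as [|n IH]; [simpl; lra|].
  assert (Hq : (0 <= p ^ S n <= 1)%R).
  { split; [apply pow_le; lra|]. rewrite <- (pow1 (S n)). apply pow_incr; lra. }
  rewrite (S_INR (S n)).
  replace (p ^ S (S n))%R with (p * p ^ S n)%R by reflexivity.
  replace ((INR (S n) + 1) * p ^ S n * (1 - p))%R
    with (p * (INR (S n) * p ^ n * (1 - p)) + p ^ S n * (1 - p))%R by (simpl; ring).
  nra.
Qed.

Definition dcoef (a : nat -> C) (n : nat) : C := INR (S n) * a (S n).

(** The factor n + 1 is absorbed by the loss of radius from [s] to [r], since (n + 1) (r/s)^n stays
    bounded. *)
Lemma tame_dcoef (a : nat -> C) : tame a -> tame (dcoef a).
Proof.
  intros Ha r Hr. set (s := ((1 + r) / 2)%R). set (p := (r / s)%R).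
  assert (Hs : (0 < s < 1)%R) by (unfold s; lra).
  destruct (Ha s Hs) as [M HM].
  assert (Hps : (p * s = r)%R) by (unfold p; field; lra).
  assert (Hp : (0 <= p < 1)%R).
  { split; [unfold p; apply Rdiv_le_0_compat; lra|].
    apply Rmult_lt_reg_r with s; [lra|]. rewrite Hps. unfold s; lra. }
  exists (/ (1 - p) * (M / s))%R; intros n.
  unfold dcoef. rewrite Cmod_mult, Cmod_R, Rabs_pos_eq by apply pos_INR.
  replace (INR (S n) * Cmod (a (S n)) * r ^ n)%R
    with ((INR (S n) * p ^ n) * ((Cmod (a (S n)) * s ^ S n) / s))%R.
  2:{ rewrite <- Hps, Rpow_mult_distr. simpl. field. lra. }
  assert (h := succ_mult_pow_le p n ltac:(lra)).
  assert (h0 : (0 <= p ^ S n)%R) by (apply pow_le; lra).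
  apply Rmult_le_compat.
  - apply Rmult_le_pos; [apply pos_INR|apply pow_le; lra].
  - apply Rdiv_le_0_compat; [|lra]. apply Rmult_le_pos; [apply Cmod_ge_0|apply pow_le; lra].
  - apply Rmult_le_reg_r with (1 - p)%R; [lra|]. rewrite Rinv_l by lra. lra.
  - apply Rmult_le_compat_r; [|apply HM]. left; apply Rinv_0_lt_compat; lra.
Qed.

(** The factor 1/2 of the second-order Taylor bound is given away so that the constant is exactly
    the one occurring in [dcoef (dcoef a)]. The induction multiplies the previous remainder by [y]
    and adds a multiple of (y - z)^2. *)
Lemma pow_taylor_remainder (y z : C) (r : R) (n : nat) :
  (Cmod y <= r)%R -> (Cmod z <= r)%R ->
  (Cmod (y ^ S (S n) - z ^ S (S n) - (y - z) * (INR (S (S n)) * z ^ S n))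
    <= INR (S n) * INR (S (S n)) * r ^ n * (Cmod (y - z) * Cmod (y - z)))%R.
Proof.
  intros Hy Hz. assert (Hr : (0 <= r)%R) by (eapply Rle_trans; [apply Cmod_ge_0|exact Hy]).
  set (h := Cmod (y - z)). assert (Hh : (0 <= h * h)%R) by nra.
  induction n as [|n IH].
  - replace (y ^ 2 - z ^ 2 - (y - z) * (INR 2 * z ^ 1)) with ((y - z) * (y - z)).
    2:{ simpl INR. rewrite RtoC_plus. simpl. ring. }
    rewrite Cmod_mult. fold h. simpl. nra.
  - replace (y ^ S (S (S n)) - z ^ S (S (S n)) - (y - z) * (INR (S (S (S n))) * z ^ S (S n)))
      with (y * (y ^ S (S n) - z ^ S (S n) - (y - z) * (INR (S (S n)) * z ^ S n))
            + (INR (S (S n)) * z ^ S n) * ((y - z) * (y - z))).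
    2:{ rewrite (S_INR (S (S n))), RtoC_plus, !Cpow_S. ring. }
    eapply Rle_trans; [apply Cmod_triangle|].
    rewrite !Cmod_mult, Cmod_pow, Cmod_R, (Rabs_pos_eq (INR _)) by apply pos_INR. fold h.
    assert (h1 : (Cmod z ^ S n <= r ^ S n)%R) by (apply pow_incr; split; [apply Cmod_ge_0|exact Hz]).
    assert (h2 := pos_INR n).
    apply Rle_trans with
      (r * (INR (S n) * INR (S (S n)) * r ^ n * (h * h)) + (INR (S (S n)) * r ^ S n) * (h * h))%R.
    + apply Rplus_le_compat.
      * apply Rmult_le_compat; try apply Cmod_ge_0; assumption.
      * apply Rmult_le_compat_r; [exact Hh|]. apply Rmult_le_compat_l; [apply pos_INR|exact h1].
    + rewrite !S_INR. replace (r ^ S n)%R with (r * r ^ n)%R by reflexivity.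
      assert (h3 : (0 <= r * r ^ n * (h * h))%R).
      { apply Rmult_le_pos; [|exact Hh]. apply Rmult_le_pos; [exact Hr|apply pow_le, Hr]. }
      nra.
Qed.

(** The termwise remainders add up to at most [D] |y - z|^2, where [D] is the sum of the absolute
    second derived series at the radius [r] halfway from |z| to 1. *)
Lemma taylor_disc_cderiv (f g : C -> C) (a : nat -> C) (z : C) :
  taylor_disc f a -> taylor_disc g (dcoef a) -> unit_disc z -> cderiv f z (g z).
Proof.
  intros Hf Hg Hz. unfold unit_disc in Hz.
  assert (Ha := taylor_disc_tame _ _ Hf).
  set (r := ((1 + Cmod z) / 2)%R).
  assert (Hz0 := Cmod_ge_0 z).
  destruct (tame_ex_series _ r (tame_dcoef _ (tame_dcoef _ Ha))) as [D HD]; [unfold r; lra|].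
  assert (HD0 : (0 <= D)%R).
  { apply (cseries_Cmod_le (fun _ => RtoC 0) _ 0 D) in HD.
    - rewrite Cmod_0 in HD; exact HD.
    - intros n. rewrite Cmod_0. apply Rmult_le_pos; [apply Cmod_ge_0|apply pow_le; unfold r; lra].
    - apply cseries_eps. intros eps He; exists 0%nat; intros n _.
      replace (csum (fun _ => RtoC 0) n) with (RtoC 0).
      + replace (0 - 0) with (RtoC 0) by ring. rewrite Cmod_0; exact He.
      + induction n as [|n IH]; [rewrite sum_O; reflexivity|]. rewrite sum_Sn, <- IH.
        change (plus ?x ?y) with (x + y). ring. }
  apply cderiv_eps; intros eps He.
  exists (Rmin ((1 - Cmod z) / 2) (eps / (D + 1))); split.
  { apply Rmin_glb_lt; [lra|]. apply Rdiv_lt_0_compat; lra. }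
  intros y Hy.
  assert (Hy1 : (Cmod (y - z) < (1 - Cmod z) / 2)%R) by (eapply Rlt_le_trans; [apply Hy|apply Rmin_l]).
  assert (Hy2 : (Cmod (y - z) < eps / (D + 1))%R) by (eapply Rlt_le_trans; [apply Hy|apply Rmin_r]).
  assert (Hyr : (Cmod y <= r)%R).
  { assert (h := Cmod_triangle_rev y z). unfold r; lra. }
  assert (Hser : cseries (fun n => a (S (S n)) *
      (y ^ S (S n) - z ^ S (S n) - (y - z) * (INR (S (S n)) * z ^ S n)))
      (f y - f z - (y - z) * g z)).
  { assert (h1 := proj1 (cpseries_cseries _ _ _) (Hf y ltac:(unfold unit_disc, r in *; lra))).
    assert (h2 := proj1 (cpseries_cseries _ _ _) (Hf z Hz)).
    assert (h3 := proj1 (cpseries_cseries _ _ _) (Hg z Hz)).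
    (* Dropping the constant term aligns the difference quotient series with the derived series.
       Dropping one more removes the term of degree 1, whose remainder is zero. *)
    assert (h4 := cseries_incr _ _ (cseries_minus _ _ _ _ (cseries_incr _ _ (cseries_minus _ _ _ _ h1 h2))
                    (cseries_scal (y - z) _ _ h3))).
    simpl in h4. unfold dcoef in h4.
    replace (f y - f z - (y - z) * g z)
      with (f y - f z - (a 0%nat * 1 - a 0%nat * 1) - (y - z) * g z -
        (a 1%nat * (y * 1) - a 1%nat * (z * 1) - (y - z) * (1%R * a 1%nat * 1))) by ring.
    eapply cseries_ext; [|exact h4]. intros n; cbv beta. simpl Cpow. ring. }
  apply Rle_trans with (Cmod (y - z) * Cmod (y - z) * D)%R.
  - eapply cseries_Cmod_le; [|exact Hser|].
    2:{ apply (is_series_scal (K := R_AbsRing) (V := R_NormedModule) (Cmod (y - z) * Cmod (y - z))%R), HD. }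
    intros n. change (scal ?x ?y) with (x * y)%R.
    cbv beta.
    rewrite Cmod_mult.
    apply Rle_trans with (Cmod (a (S (S n))) * (INR (S n) * INR (S (S n)) * r ^ n * (Cmod (y - z) * Cmod (y - z))))%R.
    + apply Rmult_le_compat_l; [apply Cmod_ge_0|]. apply pow_taylor_remainder; [exact Hyr|unfold r; lra].
    + unfold dcoef. rewrite !Cmod_mult, !Cmod_R, !(Rabs_pos_eq (INR _)) by apply pos_INR.
      apply Req_le. ring.
  - rewrite Rmult_assoc, (Rmult_comm eps). apply Rmult_le_compat_l; [apply Cmod_ge_0|].
    apply Rle_trans with (eps / (D + 1) * (D + 1))%R; [|apply Req_le; field; lra].
    apply Rmult_le_compat; try lra. apply Cmod_ge_0.
Qed.

Lemma taylor_disc_intro (a : nat -> C) : tame a -> exists f, taylor_disc f a.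
Proof.
  intros Ha.
  (* [Series] is total, so this is a function on all of C. Its values outside the disc carry no
     meaning. *)
  exists (fun z => (Series (fun n => Re (a n * z ^ n)), Series (fun n => Im (a n * z ^ n)))).
  intros z Hz. destruct (tame_sum a z Ha Hz) as [l Hl].
  destruct (proj1 (cseries_ReIm _ _) (proj1 (cpseries_cseries _ _ _) Hl)) as [h1 h2].
  rewrite (is_series_unique _ _ h1), (is_series_unique _ _ h2).
  destruct l; exact Hl.
Qed.

Lemma taylor_disc_deriv (f : C -> C) (a : nat -> C) :
  taylor_disc f a ->
  exists g, taylor_disc g (dcoef a) /\ forall z, unit_disc z -> cderiv f z (g z).
Proof.
  intros Hf.
  destruct (taylor_disc_intro _ (tame_dcoef _ (taylor_disc_tame _ _ Hf))) as [g Hg].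
  exists g; split; [exact Hg|]. intros z Hz. eapply taylor_disc_cderiv; eassumption.
Qed.

Lemma taylor_disc_0 (f : C -> C) (a : nat -> C) : taylor_disc f a -> f 0 = a 0%nat.
Proof.
  intros Hf. eapply cseries_unique.
  - apply Hf. unfold unit_disc. rewrite Cmod_0. lra.
  - apply (is_pseries_0 (K := C_AbsRing) (V := C_NormedModule)).
Qed.

(** Serves as division of [f - a 0] by z with the singularity at 0 already removed. *)
Lemma taylor_disc_shift (f : C -> C) (a : nat -> C) :
  taylor_disc f a ->
  exists h, taylor_disc h (fun n => a (S n)) /\
    forall z, unit_disc z -> f z = a 0%nat + z * h z.
Proof.
  intros Hf.
  assert (Ht : tame (fun n => a (S n))).
  { intros r Hr. destruct (taylor_disc_tame _ _ Hf r Hr) as [M HM].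
    exists (M / r)%R; intros n. apply Rmult_le_reg_r with r; [lra|].
    unfold Rdiv. rewrite (Rmult_assoc M), Rinv_l, Rmult_1_r by lra.
    specialize (HM (S n)). simpl in HM. lra. }
  destruct (taylor_disc_intro _ Ht) as [h Hh]. exists h; split; [exact Hh|].
  intros z Hz.
  assert (h1 := cseries_incr _ _ (proj1 (cpseries_cseries _ _ _) (Hf z Hz))).
  assert (h2 := cseries_scal z _ _ (proj1 (cpseries_cseries _ _ _) (Hh z Hz))).
  assert (h3 : f z - a 0%nat * z ^ 0 = z * h z).
  { eapply cseries_unique; [exact h1|].
    eapply cseries_ext; [|exact h2]. intros n; simpl; ring. }
  rewrite <- h3. simpl. ring.
Qed.

Lemma taylor_disc_bounded (f : C -> C) (a : nat -> C) (r : R) :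
  taylor_disc f a -> (0 <= r < 1)%R ->
  exists M : R, forall z, (Cmod z <= r)%R -> (Cmod (f z) <= M)%R.
Proof.
  intros Hf Hr. destruct (tame_ex_series a r (taylor_disc_tame _ _ Hf) Hr) as [M HM].
  exists M; intros z Hz. eapply cseries_Cmod_le; [| |exact HM].
  2:{ apply (proj1 (cpseries_cseries a z (f z))), Hf. unfold unit_disc; lra. }
  intros n. cbv beta. rewrite Cmod_mult, Cmod_pow.
  apply Rmult_le_compat_l; [apply Cmod_ge_0|]. apply pow_incr; split; [apply Cmod_ge_0|exact Hz].
Qed.

Lemma taylor_disc_plus (f g : C -> C) (a b : nat -> C) :
  taylor_disc f a -> taylor_disc g b ->
  taylor_disc (fun z => f z + g z) (fun n => a n + b n).
Proof.
  intros Hf Hg z Hz. apply cpseries_cseries.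
  eapply cseries_ext; [|exact (cseries_plus _ _ _ _ (proj1 (cpseries_cseries _ _ _) (Hf z Hz))
    (proj1 (cpseries_cseries _ _ _) (Hg z Hz)))].
  intros n; cbv beta; ring.
Qed.

Lemma taylor_disc_scal (c : C) (f : C -> C) (a : nat -> C) :
  taylor_disc f a -> taylor_disc (fun z => c * f z) (fun n => c * a n).
Proof.
  intros Hf z Hz. apply cpseries_cseries.
  eapply cseries_ext; [|exact (cseries_scal c _ _ (proj1 (cpseries_cseries _ _ _) (Hf z Hz)))].
  intros n; cbv beta; ring.
Qed.

Lemma taylor_disc_mult (f g : C -> C) (a b : nat -> C) :
  taylor_disc f a -> taylor_disc g b ->
  taylor_disc (fun z => f z * g z) (fun n => csum (fun k => a k * b (n - k)%nat) n).
Proof.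
  intros Hf Hg z Hz. apply cpseries_cseries.
  assert (E : forall h c, taylor_disc h c -> ex_series (fun n => Cmod (c n * z ^ n))).
  { intros h c Hh. eapply ex_series_ext; [|apply (tame_ex_series c (Cmod z))].
    - intros n; cbv beta. rewrite Cmod_mult, Cmod_pow. reflexivity.
    - eapply taylor_disc_tame, Hh.
    - split; [apply Cmod_ge_0|exact Hz]. }
  eapply cseries_ext; [|exact (cseries_mult _ _ _ _ (proj1 (cpseries_cseries _ _ _) (Hf z Hz))
    (proj1 (cpseries_cseries _ _ _) (Hg z Hz)) (E _ _ Hf) (E _ _ Hg))].
  intros n; cbv beta.
  transitivity (z ^ n * csum (fun k => a k * b (n - k)%nat) n); [|apply Cmult_comm].
  change (z ^ n * csum (fun k => a k * b (n - k)%nat) n)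
    with (scal (z ^ n) (csum (fun k => a k * b (n - k)%nat) n)).
  rewrite <- (sum_n_scal_l (K := C_AbsRing) (V := C_NormedModule)).
  apply sum_n_ext_loc. intros k Hk. change (scal ?x ?y) with (x * y).
  replace (z ^ n) with (z ^ k * z ^ (n - k)) by (rewrite <- Cpow_add_r; f_equal; lia).
  match goal with |- ?u = ?v => change (@eq C u v) end. ring.
Qed.

Lemma taylor_disc_mult_id (f : C -> C) (a : nat -> C) :
  taylor_disc f a ->
  taylor_disc (fun z => z * f z) (fun n => match n with O => RtoC 0 | S m => a m end).
Proof.
  intros Hf z Hz.
  eapply is_series_ext; [|exact (is_pseries_incr_1 (K := C_AbsRing) (V := C_NormedModule) a z (f z) (Hf z Hz))].
  intros n; destruct n; reflexivity.
Qed.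

Lemma taylor_disc_ext (f g : C -> C) (a b : nat -> C) :
  (forall z, unit_disc z -> f z = g z) -> (forall n, a n = b n) ->
  taylor_disc f a -> taylor_disc g b.
Proof.
  intros Hfg Hab Hf z Hz. rewrite <- Hfg by exact Hz.
  eapply is_pseries_ext; [exact Hab|]. apply Hf, Hz.
Qed.

(** * The power series of the logarithm *)

(** Componentwise, so that [auto_derive] and the real theorems on derivatives and integrals apply to
    curves in C. *)
Definition rderiv (g : R -> C) (t : R) (v : C) : Prop :=
  is_derive (fun s => Re (g s)) t (Re v) /\ is_derive (fun s => Im (g s)) t (Im v).

Lemma Rderiv_eps (f : R -> R) (t l : R) :
  is_derive f t l <->
  forall eps : R, (0 < eps)%R -> exists d : R, (0 < d)%R /\
    forall s : R, (Rabs (s - t) < d)%R ->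
      (Rabs (f s - f t - (s - t) * l) <= eps * Rabs (s - t))%R.
Proof.
  split.
  - intros [_ H] eps He.
    destruct (H t (fun P HP => HP) (mkposreal eps He)) as [d Hd].
    exists d; split; [apply cond_pos|].
    intros s Hs; exact (Hd s Hs).
  - intros H; split.
    + apply (is_linear_scal_l (K := R_AbsRing) (V := R_NormedModule) l).
    + intros x Hx eps.
      assert (t = x) as <-.
      { apply (is_filter_lim_locally_unique (K := R_AbsRing) (V := R_NormedModule) t x Hx). }
      destruct (H eps (cond_pos eps)) as [d [Hd Hs]].
      exists (mkposreal d Hd); intros s Hsd; exact (Hs s Hsd).
Qed.

Lemma rderiv_eps (g : R -> C) (t : R) (v : C) :
  rderiv g t v <->
  forall eps : R, (0 < eps)%R -> exists d : R, (0 < d)%R /\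
    forall s : R, (Rabs (s - t) < d)%R ->
      (Cmod (g s - g t - RtoC (s - t) * v) <= eps * Rabs (s - t))%R.
Proof.
  assert (HRe : forall s, Re (g s - g t - RtoC (s - t) * v) = (Re (g s) - Re (g t) - (s - t) * Re v)%R)
    by (intros; unfold Re; simpl; ring).
  assert (HIm : forall s, Im (g s - g t - RtoC (s - t) * v) = (Im (g s) - Im (g t) - (s - t) * Im v)%R)
    by (intros; unfold Im; simpl; ring).
  unfold rderiv. rewrite !Rderiv_eps. split.
  - intros [H1 H2] eps He.
    destruct (H1 (eps / 2)%R ltac:(lra)) as [d1 [Hd1 h1]].
    destruct (H2 (eps / 2)%R ltac:(lra)) as [d2 [Hd2 h2]].
    exists (Rmin d1 d2); split; [apply Rmin_glb_lt; assumption|].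
    intros s Hs.
    assert (k1 := h1 s (Rlt_le_trans _ _ _ Hs (Rmin_l _ _))).
    assert (k2 := h2 s (Rlt_le_trans _ _ _ Hs (Rmin_r _ _))).
    eapply Rle_trans; [apply Cmod_le_ReIm|]. rewrite HRe, HIm. lra.
  - intros H; split; intros eps He; destruct (H eps He) as [d [Hd h]]; exists d; (split; [exact Hd|]);
      intros s Hs; (eapply Rle_trans; [|apply (h s Hs)]).
    + rewrite <- HRe. apply re_le_Cmod.
    + rewrite <- HIm. apply im_le_Cmod.
Qed.

(** The error is that of [f] at the increment of [g], plus [l] times that of [g]. Near [t] the
    increment of [g] is at most [K] |s - t|, and [L] exceeds |l|, so each part costs half of
    [eps]. *)
Lemma cderiv_rderiv (f : C -> C) (g : R -> C) (t : R) (l v : C) :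
  cderiv f (g t) l -> rderiv g t v -> rderiv (fun s => f (g s)) t (v * l).
Proof.
  intros Hf Hg. apply rderiv_eps; intros eps He.
  rewrite cderiv_eps in Hf. rewrite rderiv_eps in Hg.
  set (K := (Cmod v + 1)%R). set (L := (Cmod l + 1)%R).
  assert (HK : (0 < K)%R) by (unfold K; assert (h := Cmod_ge_0 v); lra).
  assert (HL : (0 < L)%R) by (unfold L; assert (h := Cmod_ge_0 l); lra).
  destruct (Hg 1%R Rlt_0_1) as [d1 [Hd1 h1]].
  destruct (Hg (eps / (2 * L))%R) as [d2 [Hd2 h2]]; [apply Rdiv_lt_0_compat; lra|].
  destruct (Hf (eps / (2 * K))%R) as [d3 [Hd3 h3]]; [apply Rdiv_lt_0_compat; lra|].
  exists (Rmin (Rmin d1 d2) (d3 / K)); split.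
  { repeat apply Rmin_glb_lt; try assumption. apply Rdiv_lt_0_compat; assumption. }
  intros s Hs.
  assert (Hs1 : (Rabs (s - t) < d1)%R) by (eapply Rlt_le_trans; [exact Hs|]; eapply Rle_trans; [apply Rmin_l|apply Rmin_l]).
  assert (Hs2 : (Rabs (s - t) < d2)%R) by (eapply Rlt_le_trans; [exact Hs|]; eapply Rle_trans; [apply Rmin_l|apply Rmin_r]).
  assert (Hs3 : (Rabs (s - t) < d3 / K)%R) by (eapply Rlt_le_trans; [exact Hs|]; apply Rmin_r).
  assert (k1 := h1 s Hs1). assert (k2 := h2 s Hs2).
  assert (Hinc : (Cmod (g s - g t) <= K * Rabs (s - t))%R).
  { replace (g s - g t) with ((g s - g t - RtoC (s - t) * v) + RtoC (s - t) * v) by ring.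
    eapply Rle_trans; [apply Cmod_triangle|]. rewrite Cmod_mult, Cmod_R. unfold K. lra. }
  assert (k3 : (Cmod (g s - g t) < d3)%R).
  { eapply Rle_lt_trans; [exact Hinc|]. rewrite Rmult_comm.
    apply Rmult_lt_reg_r with (/ K)%R; [apply Rinv_0_lt_compat, HK|].
    rewrite Rmult_assoc, Rinv_r by lra. lra. }
  specialize (h3 _ k3).
  replace (f (g s) - f (g t) - RtoC (s - t) * (v * l))
    with ((f (g s) - f (g t) - (g s - g t) * l) + (g s - g t - RtoC (s - t) * v) * l) by ring.
  eapply Rle_trans; [apply Cmod_triangle|]. rewrite (Cmod_mult _ l).
  assert (Hl0 := Cmod_ge_0 l).
  assert (Habs := Rabs_pos (s - t)).
  apply Rle_trans with (eps / (2 * K) * (K * Rabs (s - t)) + eps / (2 * L) * Rabs (s - t) * L)%R.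
  - apply Rplus_le_compat.
    + eapply Rle_trans; [exact h3|]. apply Rmult_le_compat_l; [|exact Hinc].
      left; apply Rdiv_lt_0_compat; lra.
    + apply Rmult_le_compat; [apply Cmod_ge_0|exact Hl0|exact k2|unfold L; lra].
  - apply Req_le. field. lra.
Qed.

(** Replaces the case distinction on the sign of the imaginary part by a formula that can be
    differentiated. It covers all that is needed, since 1 + z lies in the right half-plane for z in
    the disc. *)
Lemma Carg_atan (x y : R) : (0 < x)%R -> Carg (x, y) = atan (y / x).
Proof.
  intros Hx. unfold Carg. change (Im (x, y)) with y. change (Re (x, y)) with x.
  assert (Hm : Cmod (x, y) = sqrt (x ^ 2 + y ^ 2)) by reflexivity.
  set (m := Cmod (x, y)) in *.
  assert (Hm0 : (0 < m)%R) by (rewrite Hm; apply sqrt_lt_R0; nra).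
  assert (Hm2 : (m * m = x ^ 2 + y ^ 2)%R) by (rewrite Hm; apply sqrt_sqrt; nra).
  assert (Ha : acos (x / m) = atan (Rabs y / x)).
  { rewrite acos_atan by (apply Rdiv_lt_0_compat; assumption).
    f_equal. replace (1 - (x / m)²)%R with ((y / m)²)%R.
    2:{ unfold Rsqr. apply Rmult_eq_reg_r with (m * m)%R; [|nra].
        replace (y / m * (y / m) * (m * m))%R with (y * y)%R by (field; lra).
        replace ((1 - x / m * (x / m)) * (m * m))%R with (m * m - x * x)%R by (field; lra). nra. }
    rewrite sqrt_Rsqr_abs, Rabs_div by lra. rewrite (Rabs_pos_eq m) by lra. field. lra. }
  destruct (Rle_dec 0 y) as [Hy|Hy]; rewrite Ha.
  - rewrite Rabs_pos_eq by exact Hy. reflexivity.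
  - rewrite Rabs_left by lra. rewrite <- atan_opp. f_equal. field. lra.
Qed.

Definition lcoef (n : nat) : C :=
  match n with O => RtoC 0 | S m => RtoC ((-1) ^ m / INR (S m)) end.

Lemma lcoef_tame : tame lcoef.
Proof.
  intros r Hr; exists 1%R; intros n.
  assert (Hrn : (0 <= r ^ n <= 1)%R).
  { split; [apply pow_le; lra|]. rewrite <- (pow1 n). apply pow_incr; lra. }
  destruct n as [|n]; unfold lcoef; rewrite Cmod_R; [rewrite Rabs_R0; lra|].
  assert (Hn := lt_0_INR (S n) ltac:(lia)).
  assert (Hn1 : (1 <= INR (S n))%R) by (rewrite S_INR; assert (h := pos_INR n); lra).
  rewrite Rabs_div by (apply not_0_INR; lia). rewrite pow_1_abs.
  rewrite (Rabs_pos_eq (INR (S n))) by lra.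
  apply Rle_trans with (1 / INR (S n) * 1)%R.
  - apply Rmult_le_compat_l; [|lra]. apply Rdiv_le_0_compat; lra.
  - rewrite Rmult_1_r. apply Rmult_le_reg_r with (INR (S n)); [lra|]. unfold Rdiv.
    rewrite Rmult_assoc, Rinv_l by lra. lra.
Qed.

(** The coefficients are (-1)^n, so shifting them changes only their sign and the sum satisfies T =
    1 - z T. *)
Lemma geometric_taylor (T : C -> C) :
  taylor_disc T (dcoef lcoef) -> forall z, unit_disc z -> T z = / (1 + z).
Proof.
  intros HT z Hz.
  assert (Hc : forall n, dcoef lcoef n = RtoC ((-1) ^ n)).
  { intros n. unfold dcoef, lcoef. rewrite <- RtoC_mult. f_equal. field. apply not_0_INR; lia. }
  destruct (taylor_disc_shift _ _ HT) as [h [Hh HTh]].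
  assert (Hh' : h z = (-1)%R * T z).
  { eapply cseries_unique; [apply (Hh z Hz)|].
    assert (H2 := taylor_disc_scal (RtoC (-1)) _ _ HT z Hz).
    eapply is_pseries_ext; [|exact H2]. intros n; cbv beta. rewrite !Hc, <- RtoC_mult. reflexivity. }
  assert (Hz1 : 1 + z <> 0).
  { intros H. apply (f_equal (fun y => y - 1)) in H. replace (1 + z - 1) with z in H by ring.
    unfold unit_disc in Hz. rewrite H in Hz. replace (0 - 1) with (- (1)) in Hz by ring.
    rewrite Cmod_opp, Cmod_1 in Hz. lra. }
  assert (E := HTh z Hz). rewrite Hh', Hc in E. simpl in E.
  set (t := T z) in *. clearbody t.
  replace (/ (1 + z)) with ((t + z * t) / (1 + z)).
  - field. exact Hz1.
  - rewrite E at 1. field. exact Hz1.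
Qed.

Lemma rderiv_segment (z : C) (t : R) : rderiv (fun s => RtoC s * z) t z.
Proof.
  split; unfold Re, Im; simpl; auto_derive; trivial; ring.
Qed.

Lemma unit_disc_segment (z : C) (t : R) :
  unit_disc z -> (0 <= t <= 1)%R -> unit_disc (RtoC t * z).
Proof.
  unfold unit_disc; intros Hz Ht. rewrite Cmod_mult, Cmod_R, Rabs_pos_eq by lra.
  assert (h := Cmod_ge_0 z). nra.
Qed.

Lemma unit_disc_Re (z : C) : unit_disc z -> (-1 < Re z < 1)%R.
Proof.
  unfold unit_disc; intros Hz. apply and_comm, Rabs_def2.
  eapply Rle_lt_trans; [apply re_le_Cmod|exact Hz].
Qed.

Lemma unit_disc_1_plus (z : C) : unit_disc z -> 1 + z <> 0.
Proof.
  intros Hz H. apply (f_equal Re) in H. assert (h := unit_disc_Re z Hz).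
  unfold Re in *; simpl in H. lra.
Qed.

Lemma Clog_1_plus (z : C) : (0 < 1 + Re z)%R ->
  Clog (1 + z) = (ln (sqrt ((1 + Re z) ^ 2 + (Im z) ^ 2)), atan (Im z / (1 + Re z))).
Proof.
  intros H. unfold Clog. destruct z as [x y]. unfold Re, Im in *; simpl in H |- *.
  unfold Cplus; simpl. rewrite Carg_atan by exact H.
  unfold Cmod; simpl. repeat f_equal; ring.
Qed.

(** Along the segment from 0 to [z] the sum of the series and the explicit logarithm both have
    derivative z / (1 + t z) in t, and both vanish at t = 0. Holomorphy of the logarithm is not
    presupposed; it is a consequence, by termwise differentiation. *)
Lemma Clog_taylor : taylor_disc (fun z => Clog (1 + z)) lcoef.
Proof.
  destruct (taylor_disc_intro _ lcoef_tame) as [S HS].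
  destruct (taylor_disc_deriv _ _ HS) as [T [HT HST]].
  assert (HT' := geometric_taylor T HT).
  apply (taylor_disc_ext S _ lcoef lcoef); [|reflexivity|exact HS].
  intros z Hz.
  set (x := Re z). set (y := Im z).
  assert (Hx : forall t, (0 <= t <= 1)%R -> (0 < 1 + t * x)%R).
  { intros t Ht. assert (h := unit_disc_Re _ (unit_disc_segment z t Hz Ht)).
    rewrite re_scal_l in h. fold x in h. lra. }
  assert (HD : forall t, (0 <= t <= 1)%R -> rderiv (fun s => S (RtoC s * z)) t (z * / (1 + RtoC t * z))).
  { intros t Ht. assert (Htz := unit_disc_segment z t Hz Ht). rewrite <- HT' by exact Htz.
    apply (cderiv_rderiv S (fun s => RtoC s * z)); [apply HST, Htz|apply rderiv_segment]. }
  assert (HN : forall t, (0 <= t <= 1)%R -> (0 < (1 + t * x) ^ 2 + (t * y) ^ 2)%R).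
  { intros t Ht. assert (h := Hx t Ht). nra. }
  assert (HQ : forall t, (0 <= t <= 1)%R -> z * / (1 + RtoC t * z) =
    (((x * (1 + t * x) + y * (t * y)) / ((1 + t * x) ^ 2 + (t * y) ^ 2))%R,
     (y / ((1 + t * x) ^ 2 + (t * y) ^ 2))%R)).
  { intros t Ht. assert (h := HN t Ht). unfold x, y in *. clear - h. destruct z as [p q].
    unfold Re, Im in *; simpl in h |- *. unfold Cinv, Cmult, Cplus, RtoC; simpl.
    apply injective_projections; simpl; field; nra. }
  assert (H01 : forall t, (0 <= t <= 1)%R ->
     is_derive (fun s => Re (S (RtoC s * z)%C) - ln (sqrt ((1 + s * x) ^ 2 + (s * y) ^ 2)))%R t 0%R).
  { intros t Ht. destruct (HD t Ht) as [h _]. rewrite (HQ t Ht) in h.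
    assert (hn := HN t Ht).
    assert (hs := sqrt_lt_R0 _ hn). assert (hss := sqrt_sqrt _ (Rlt_le _ _ hn)).
    assert (h2 : is_derive (fun s => ln (sqrt ((1 + s * x) ^ 2 + (s * y) ^ 2)))%R t
      ((x * (1 + t * x) + y * (t * y)) / ((1 + t * x) ^ 2 + (t * y) ^ 2))%R).
    { auto_derive.
      - repeat split; [simpl in hn; lra|]. simpl in hs. exact hs || (rewrite ?Rmult_1_r in *; lra).
      - simpl in *. rewrite !Rmult_1_r in *.
        set (n := ((1 + t * x) * (1 + t * x) + t * y * (t * y))%R) in *.
        rewrite Rmult_assoc, <- Rinv_mult.
        replace (2 * sqrt n * sqrt n)%R with (2 * n)%R by (rewrite Rmult_assoc, hss; ring).
        field. lra. }
    assert (h3 := is_derive_minus _ _ _ _ _ h h2).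
    replace 0%R with (minus (Re (((x * (1 + t * x) + y * (t * y)) / ((1 + t * x) ^ 2 + (t * y) ^ 2))%R,
     (y / ((1 + t * x) ^ 2 + (t * y) ^ 2))%R)) ((x * (1 + t * x) + y * (t * y)) / ((1 + t * x) ^ 2 + (t * y) ^ 2))%R)
     by (unfold minus, plus, opp, Re; simpl; ring).
    exact h3. }
  assert (H02 : forall t, (0 <= t <= 1)%R ->
     is_derive (fun s => Im (S (RtoC s * z)%C) - atan ((s * y) / (1 + s * x)))%R t 0%R).
  { intros t Ht. destruct (HD t Ht) as [_ h]. rewrite (HQ t Ht) in h.
    assert (hn := HN t Ht). assert (hx := Hx t Ht).
    assert (h2 : is_derive (fun s => atan ((s * y) / (1 + s * x)))%R t
      (y / ((1 + t * x) ^ 2 + (t * y) ^ 2))%R).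
    { auto_derive.
      - lra.
      - unfold Rsqr. field. repeat split; simpl in hn; try nra. }
    assert (h3 := is_derive_minus _ _ _ _ _ h h2).
    replace 0%R with (minus (Im (((x * (1 + t * x) + y * (t * y)) / ((1 + t * x) ^ 2 + (t * y) ^ 2))%R,
     (y / ((1 + t * x) ^ 2 + (t * y) ^ 2))%R)) (y / ((1 + t * x) ^ 2 + (t * y) ^ 2))%R)
     by (unfold minus, plus, opp, Im; simpl; ring).
    exact h3. }
  assert (S0 : S (RtoC 0 * z) = 0).
  { rewrite Cmult_0_l. apply (taylor_disc_0 S lcoef HS). }
  assert (E1 := eq_is_derive _ 0 1 H01 Rlt_0_1).
  assert (E2 := eq_is_derive _ 0 1 H02 Rlt_0_1).
  simpl in E1, E2. rewrite S0, Cmult_1_l in E1, E2.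
  rewrite Clog_1_plus by (assert (h := Hx 1%R ltac:(lra)); fold x; lra).
  fold x y.
  assert (A0 : ln (sqrt ((1 + 0 * x) * ((1 + 0 * x) * 1) + 0 * y * (0 * y * 1))) = 0%R).
  { replace ((1 + 0 * x) * ((1 + 0 * x) * 1) + 0 * y * (0 * y * 1))%R with 1%R by ring.
    rewrite sqrt_1. apply ln_1. }
  assert (A1 : atan (0 * y / (1 + 0 * x)) = 0%R).
  { replace (0 * y / (1 + 0 * x))%R with 0%R by (field; lra). apply atan_0. }
  apply injective_projections; simpl.
  - change (fst (S z)) with (Re (S z)). rewrite A0 in E1.
    replace ((1 + x) * ((1 + x) * 1) + y * (y * 1))%R with ((1 + 1 * x) * ((1 + 1 * x) * 1) + 1 * y * (1 * y * 1))%R by ring.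
    unfold Re at 1 in E1; simpl in E1. lra.
  - change (snd (S z)) with (Im (S z)). rewrite A1 in E2.
    replace (y / (1 + x))%R with ((1 * y) / (1 + 1 * x))%R by (f_equal; ring || (f_equal; ring)).
    unfold Im at 1 in E2; simpl in E2. lra.
Qed.

(** * Circle means and Bessel's inequality *)

Definition punctured (z : C) : Prop := (0 < Cmod z < 1)%R.

Definition C1p (f : C -> C) : Prop :=
  exists f' : C -> C, forall z, punctured z -> cderiv f z (f' z) /\ ccont f' z.

Lemma C1p_const (c : C) : C1p (fun _ => c).
Proof.
  exists (fun _ => RtoC 0); intros z _; split; [apply cderiv_const|apply ccont_const].
Qed.

Lemma C1p_id : C1p (fun z => z).
Proof.
  exists (fun _ => RtoC 1); intros z _; split; [apply cderiv_id|apply ccont_const].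
Qed.

Lemma C1p_plus (f g : C -> C) : C1p f -> C1p g -> C1p (fun z => f z + g z).
Proof.
  intros [f' Hf] [g' Hg]. exists (fun z => f' z + g' z); intros z Hz.
  destruct (Hf z Hz) as [f1 f2], (Hg z Hz) as [g1 g2].
  split; [apply cderiv_plus|apply ccont_plus]; assumption.
Qed.

Lemma C1p_mult (f g : C -> C) : C1p f -> C1p g -> C1p (fun z => f z * g z).
Proof.
  intros [f' Hf] [g' Hg]. exists (fun z => f' z * g z + f z * g' z); intros z Hz.
  destruct (Hf z Hz) as [f1 f2], (Hg z Hz) as [g1 g2].
  split; [apply cderiv_mult; assumption|].
  apply ccont_plus; apply ccont_mult; try assumption; eapply cderiv_ccont; eassumption.
Qed.

Lemma C1p_inv (f : C -> C) :
  (forall z, punctured z -> f z <> 0) -> C1p f -> C1p (fun z => / f z).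
Proof.
  intros Hf0 [f' Hf]. exists (fun z => f' z * - / (f z * f z)); intros z Hz.
  destruct (Hf z Hz) as [f1 f2]. assert (h := Hf0 z Hz).
  split; [apply cderiv_inv; assumption|].
  assert (f3 := cderiv_ccont _ _ _ f1).
  apply ccont_mult; [exact f2|].
  assert (h2 : ccont (fun y => 0 - / (f y * f y)) z).
  { apply ccont_minus; [apply ccont_const|]. apply ccont_inv; [apply Cmult_neq_0; exact h|].
    apply ccont_mult; exact f3. }
  intros eps He. destruct (h2 eps He) as [d [Hd k]]. exists d; split; [exact Hd|].
  intros y Hy. specialize (k y Hy).
  replace (- / (f y * f y) - - / (f z * f z)) with (0 - / (f y * f y) - (0 - / (f z * f z))) by ring.
  exact k.
Qed.

Lemma C1p_ext (f g : C -> C) : (forall z, f z = g z) -> C1p f -> C1p g.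
Proof.
  intros H [f' Hf]. exists f'; intros z Hz. destruct (Hf z Hz) as [h1 h2].
  split; [eapply cderiv_ext; eassumption|exact h2].
Qed.

Lemma C1p_pow (f : C -> C) (n : nat) : C1p f -> C1p (fun z => f z ^ n).
Proof.
  intros Hf. induction n as [|n IH]; [apply (C1p_const 1)|].
  apply (C1p_mult f (fun z => f z ^ n)); assumption.
Qed.

Lemma C1p_csum (u : nat -> C -> C) (n : nat) :
  (forall k, C1p (u k)) -> C1p (fun z => csum (fun k => u k z) n).
Proof.
  intros H. induction n as [|n IH].
  - apply (C1p_ext (u 0%nat)); [|apply H]. intros z; rewrite sum_O; reflexivity.
  - apply (C1p_ext (fun z => csum (fun k => u k z) n + u (S n) z)).
    + intros z; rewrite sum_Sn; reflexivity.
    + apply C1p_plus; [exact IH|apply H].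
Qed.

Definition circ (s t : R) : C := (s * cos t, s * sin t)%R.

Lemma Cmod_circ (s t : R) : (0 <= s)%R -> Cmod (circ s t) = s.
Proof.
  intros Hs. unfold Cmod, circ; simpl.
  replace (s * cos t * (s * cos t * 1) + s * sin t * (s * sin t * 1))%R
    with (s * s * (Rsqr (sin t) + Rsqr (cos t)))%R by (unfold Rsqr; ring).
  rewrite sin2_cos2, Rmult_1_r. apply sqrt_square, Hs.
Qed.

Lemma punctured_circ (s t : R) : (0 < s < 1)%R -> punctured (circ s t).
Proof. intros Hs. unfold punctured. rewrite Cmod_circ; lra. Qed.

Lemma rderiv_circ_angle (s t : R) : rderiv (circ s) t (Ci * circ s t).
Proof.
  split; unfold Re, Im, circ; simpl; auto_derive; trivial; ring.
Qed.

Lemma rderiv_circ_radius (s t : R) : rderiv (fun r => circ r t) s (circ 1 t).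
Proof.
  split; unfold Re, Im, circ; simpl; auto_derive; trivial; ring.
Qed.

(** Joint continuity in radius and angle is the hypothesis for differentiating an integral with
    respect to a parameter. *)
Lemma continuity_2d_circ (K : C -> C) (s t : R) :
  ccont K (circ s t) -> continuity_2d_pt (fun u v => Re (K (circ u v))) s t.
Proof.
  intros HK eps. destruct (HK eps (cond_pos eps)) as [d [Hd Hy]].
  assert (Hd2 : (0 < d / 2)%R) by lra.
  assert (c1 : continuity_2d_pt (fun u v => u * cos v)%R s t).
  { apply continuity_2d_pt_mult; [apply continuity_2d_pt_id1|].
    apply (continuity_1d_2d_pt_comp cos (fun _ v => v)); [apply continuity_cos|apply continuity_2d_pt_id2]. }
  assert (c2 : continuity_2d_pt (fun u v => u * sin v)%R s t).
  { apply continuity_2d_pt_mult; [apply continuity_2d_pt_id1|].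
    apply (continuity_1d_2d_pt_comp sin (fun _ v => v)); [apply continuity_sin|apply continuity_2d_pt_id2]. }
  specialize (c1 (mkposreal _ Hd2)). specialize (c2 (mkposreal _ Hd2)).
  assert (c := locally_2d_and _ _ _ _ c1 c2).
  eapply locally_2d_impl; [|exact c].
  apply locally_2d_forall. intros u v [h1 h2]. simpl in h1, h2.
  eapply Rle_lt_trans; [|apply (Hy (circ u v))].
  - change (Re (K (circ u v)) - Re (K (circ s t)))%R with (Re (K (circ u v) - K (circ s t))).
    apply re_le_Cmod.
  - eapply Rle_lt_trans; [apply Cmod_le_ReIm|].
    change (Re (circ u v - circ s t)) with (u * cos v - s * cos t)%R.
    change (Im (circ u v - circ s t)) with (u * sin v - s * sin t)%R. lra.
Qed.

Lemma continuous_circ (K : C -> C) (s t : R) :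
  ccont K (circ s t) -> continuous (fun v => Re (K (circ s v))) t.
Proof.
  intros HK. apply filterlim_locally. intros eps.
  destruct (continuity_2d_circ K s t HK eps) as [d Hd].
  exists d. intros v Hv. apply Hd; [|exact Hv].
  replace (s - s)%R with 0%R by ring. rewrite Rabs_R0. apply cond_pos.
Qed.

(** Not divided by 2 pi, and restricted to the real part, which is all that expanding |g - p|^2
    calls for. *)
Notation mean f s := (RInt (fun t => Re (f (circ s t))) 0 (2 * PI)).

Lemma ex_RInt_circ (f : C -> C) (s : R) :
  C1p f -> (0 < s < 1)%R -> ex_RInt (fun t => Re (f (circ s t))) 0 (2 * PI).
Proof.
  intros [f' Hf] Hs. apply (ex_RInt_continuous (V := R_CompleteNormedModule)). intros t _.
  apply continuous_circ. eapply cderiv_ccont. apply Hf, punctured_circ, Hs.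
Qed.

(* [z K'] integrates to zero over circles because [Re (z K'(z))] is the angular derivative of [Im K]. *)
Lemma is_RInt_circ_zK' (K K' : C -> C) (s : R) :
  (0 < s < 1)%R ->
  (forall z, punctured z -> cderiv K z (K' z) /\ ccont K' z) ->
  is_RInt (fun t => Re (circ s t * K' (circ s t))) 0 (2 * PI) 0.
Proof.
  intros Hs HK.
  replace 0%R with (minus (Im (K (circ s (2 * PI)))) (Im (K (circ s 0)))) at 2.
  2:{ unfold circ. rewrite cos_2PI, sin_2PI, cos_0, sin_0. apply (minus_eq_zero (G := R_AbelianGroup)). }
  apply (is_RInt_derive (V := R_CompleteNormedModule) (fun t => Im (K (circ s t)))).
  - intros t _. destruct (HK _ (punctured_circ s t Hs)) as [h1 _].
    destruct (cderiv_rderiv K (circ s) t _ _ h1 (rderiv_circ_angle s t)) as [_ h].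
    replace (Re (circ s t * K' (circ s t))) with (Im (Ci * circ s t * K' (circ s t))); [exact h|].
    unfold Re, Im, Ci; simpl; ring.
  - intros t _. apply (continuous_circ (fun z => z * K' z)).
    apply ccont_mult; [apply ccont_id|]. apply HK, punctured_circ, Hs.
Qed.

(** The radial derivative of [Re f] at radius u is Re (z f'(z)) / u, and [z f'] integrates to zero
    over each circle. So the derivative of the mean with respect to the radius vanishes. *)
Lemma mean_const (f : C -> C) (r s : R) :
  C1p f -> (0 < r < s)%R -> (s < 1)%R -> mean f r = mean f s.
Proof.
  intros Hf Hr Hs. destruct (Hf) as [f' Hf'].
  apply (eq_is_derive (V := R_NormedModule) (fun u => mean f u) r s); [|lra].
  intros u Hu. assert (Hu' : (0 < u < 1)%R) by lra.
  assert (HD : forall x t, (0 < x < 1)%R ->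
    is_derive (fun y => Re (f (circ y t))) x (/ x * Re (circ x t * f' (circ x t)))%R).
  { intros x t Hx.
    destruct (cderiv_rderiv f (fun y => circ y t) x _ _ (proj1 (Hf' _ (punctured_circ x t Hx))) (rderiv_circ_radius x t)) as [h _].
    replace (/ x * Re (circ x t * f' (circ x t)))%R with (Re (circ 1 t * f' (circ x t))); [exact h|].
    unfold Re, circ; simpl. field. lra. }
  assert (Hloc : locally u (fun x => (0 < x < 1)%R)).
  { apply (locally_interval _ u 0 1); simpl; try lra. intros y; simpl; lra. }
  assert (E : RInt (fun t => Derive (fun x => Re (f (circ x t))) u) 0 (2 * PI) = 0%R).
  { apply is_RInt_unique.
    apply (is_RInt_ext (fun t => scal (/ u)%R (Re (circ u t * f' (circ u t))))).
    - intros t _. symmetry. apply is_derive_unique. apply HD, Hu'.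
    - assert (Z : scal (/ u)%R 0%R = 0%R :> R) by (unfold scal; simpl; unfold mult; simpl; ring).
      refine (eq_ind _ (fun l : R => is_RInt _ 0 (2 * PI) l) _ _ Z).
      exact (is_RInt_scal _ _ _ (/ u)%R _ (is_RInt_circ_zK' f f' u Hu' Hf')). }
  refine (eq_ind _ (fun l : R => is_derive (fun x => mean f x) u l) _ _ E).
  apply (is_derive_RInt_param (fun y t => Re (f (circ y t))) 0 (2 * PI) u).
  - eapply filter_imp; [|exact Hloc]. intros x Hx t _. eexists. apply HD, Hx.
  - intros t _.
    apply (continuity_2d_pt_ext_loc (fun x v => / x * Re (circ x v * f' (circ x v)))%R).
    + assert (h : locally_2d (fun x v => (0 < x < 1)%R) u t).
      { destruct Hloc as [d Hd]. exists d. intros x v Hx _. apply Hd, Hx. }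
      eapply locally_2d_impl; [|exact h]. apply locally_2d_forall.
      intros x v Hx. symmetry. apply is_derive_unique, HD, Hx.
    + apply continuity_2d_pt_mult.
      * apply continuity_2d_pt_inv; [apply continuity_2d_pt_id1|lra].
      * apply (continuity_2d_circ (fun z => z * f' z)).
        apply ccont_mult; [apply ccont_id|]. apply Hf', punctured_circ, Hu'.
  - eapply filter_imp; [|exact Hloc]. intros x Hx. apply ex_RInt_circ; assumption.
Qed.

Lemma punctured_neq_0 (z : C) : punctured z -> z <> 0.
Proof. intros Hz. apply Cmod_gt_0, Hz. Qed.

(** For different exponents the integrand is z times a power of z other than 1/z; that power has a
    primitive off 0, and the integral vanishes. For equal exponents the integrand is constant. *)
Lemma is_RInt_circ_monomial (a : C) (j k : nat) (s : R) :
  (0 < s < 1)%R ->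
  is_RInt (fun t => Re (a * circ s t ^ j * (/ circ s t) ^ k)) 0 (2 * PI)
    (if Nat.eqb j k then 2 * PI * Re a else 0)%R.
Proof.
  intros Hs.
  assert (Hn : forall m, RtoC (INR (S m)) <> 0).
  { intros m H. apply RtoC_inj in H. revert H. apply not_0_INR; lia. }
  destruct (Nat.eqb_spec j k) as [->|Hjk].
  - apply (is_RInt_ext (fun _ => Re a)).
    + intros t _. f_equal. rewrite <- Cmult_assoc, <- Cpow_mult_l, Cinv_r.
      * rewrite Cpow_1_l. ring.
      * apply punctured_neq_0, punctured_circ, Hs.
    + replace (2 * PI * Re a)%R with (scal (2 * PI - 0)%R (Re a)) by (unfold scal; simpl; unfold mult; simpl; ring).
      apply (is_RInt_const (V := R_NormedModule)).
  - destruct (Nat.lt_total j k) as [H|[H|H]]; [|contradiction|].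
    + destruct (Nat.le_exists_sub (S j) k H) as [m [Hm _]].
      replace k with (j + S m)%nat by lia.
      apply (is_RInt_ext (fun t => Re (circ s t * (a * (/ circ s t) ^ S (S m))))).
      * intros t _. f_equal. assert (hz := punctured_neq_0 _ (punctured_circ s t Hs)).
        rewrite Cpow_add_r.
        replace (a * circ s t ^ j * ((/ circ s t) ^ j * (/ circ s t) ^ S m))
          with (a * (circ s t * / circ s t) ^ j * (/ circ s t) ^ S m) by (rewrite Cpow_mult_l; ring).
        rewrite Cinv_r, Cpow_1_l by exact hz. rewrite (Cpow_S _ (S m)).
        replace (circ s t * (a * (/ circ s t * (/ circ s t) ^ S m)))
          with ((circ s t * / circ s t) * (a * (/ circ s t) ^ S m)) by ring.
        rewrite Cinv_r by exact hz. ring.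
      * apply (is_RInt_circ_zK' (fun z => - / INR (S m) * a * (/ z) ^ S m) (fun z => a * (/ z) ^ S (S m)) s Hs).
        intros z Hz. assert (hz := punctured_neq_0 _ Hz).
        assert (hi := cderiv_inv_id z hz). split.
        -- replace (a * (/ z) ^ S (S m)) with
             (0 * (/ z) ^ S m + (- / INR (S m) * a) * (- / (z * z) * (INR (S m) * (/ z) ^ m))).
           2:{ rewrite !Cpow_S. field. split; [exact hz|apply Hn]. }
           apply (cderiv_mult (fun _ => - / INR (S m) * a) (fun z => (/ z) ^ S m)); [apply cderiv_const|].
           apply (cderiv_comp (fun y => y ^ S m) Cinv); [apply cderiv_pow|exact hi].
        -- apply ccont_mult; [apply ccont_const|].
           eapply cderiv_ccont. apply (cderiv_comp (fun y => y ^ S (S m)) Cinv); [apply cderiv_pow|exact hi].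
    + destruct (Nat.le_exists_sub (S k) j H) as [m [Hm _]].
      replace j with (k + S m)%nat by lia.
      apply (is_RInt_ext (fun t => Re (circ s t * (a * circ s t ^ m)))).
      * intros t _. f_equal. assert (hz := punctured_neq_0 _ (punctured_circ s t Hs)).
        rewrite Cpow_add_r.
        replace (a * (circ s t ^ k * circ s t ^ S m) * (/ circ s t) ^ k)
          with (a * (circ s t * / circ s t) ^ k * circ s t ^ S m) by (rewrite Cpow_mult_l; ring).
        rewrite Cinv_r, Cpow_1_l by exact hz. rewrite Cpow_S. ring.
      * apply (is_RInt_circ_zK' (fun z => / INR (S m) * a * z ^ S m) (fun z => a * z ^ m) s Hs).
        intros z Hz. split.
        -- replace (a * z ^ m) with (0 * z ^ S m + (/ INR (S m) * a) * (INR (S m) * z ^ m)).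
           2:{ field. apply Hn. }
           apply (cderiv_mult (fun _ => / INR (S m) * a) (fun z => z ^ S m)); [apply cderiv_const|apply cderiv_pow].
        -- apply ccont_mult; [apply ccont_const|]. destruct m; [exact (ccont_const 1 z)|].
           eapply cderiv_ccont, cderiv_pow.
Qed.

Lemma is_RInt_csum (u : nat -> R -> C) (v : nat -> R) (a b : R) (n : nat) :
  (forall k, is_RInt (fun t => Re (u k t)) a b (v k)) ->
  is_RInt (fun t => Re (csum (fun k => u k t) n)) a b (sum_n v n).
Proof.
  intros H. induction n as [|n IH].
  - rewrite sum_O. eapply is_RInt_ext; [|apply (H 0%nat)]. intros t _. rewrite sum_O. reflexivity.
  - rewrite sum_Sn. eapply is_RInt_ext; [|apply (is_RInt_plus _ _ _ _ _ _ IH (H (S n)))].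
    intros t _. rewrite sum_Sn. reflexivity.
Qed.

Lemma sum_n_delta (x : nat -> R) (j n : nat) :
  sum_n (fun k => if Nat.eqb j k then x k else 0%R) n = if Nat.leb j n then x j else 0%R.
Proof.
  induction n as [|n IH].
  - rewrite sum_O. destruct j; reflexivity.
  - rewrite sum_Sn, IH. unfold plus; simpl AbelianMonoid.plus; cbv beta.
    destruct (Nat.eqb_spec j (S n)) as [->|H].
    + rewrite (proj2 (Nat.leb_gt (S n) n)), Nat.leb_refl by lia. simpl. ring.
    + destruct (Nat.leb_spec j n), (Nat.leb_spec j (S n)); try lia; simpl; ring.
Qed.

Lemma csum_mult_l (c : C) (u : nat -> C) (n : nat) :
  c * csum u n = csum (fun k => c * u k) n.
Proof. symmetry. exact (sum_n_scal_l (K := C_AbsRing) (V := C_NormedModule) c u n). Qed.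

Lemma csum_conj (u : nat -> C) (n : nat) :
  Cconj (csum u n) = csum (fun k => Cconj (u k)) n.
Proof.
  induction n as [|n IH]; [rewrite !sum_O; reflexivity|].
  rewrite !sum_Sn, <- IH. change (plus ?x ?y) with (x + y). apply Cplus_conj.
Qed.

(** Bernoulli's inequality, used to let a radius approach 1 without taking limits. *)
Lemma one_minus_pow_ge (x : R) (n : nat) :
  (0 <= x <= 1)%R -> (1 - INR n * x <= (1 - x) ^ n)%R.
Proof.
  intros Hx. induction n as [|n IH]; [simpl; lra|].
  rewrite S_INR. simpl pow.
  assert (h := pos_INR n).
  apply Rle_trans with ((1 - x) * (1 - INR n * x))%R; [nra|].
  apply Rmult_le_compat_l; lra.
Qed.

(** * Bessel's inequality *)

Definition tpoly (c : nat -> C) (N : nat) (z : C) : C := csum (fun k => c k * z ^ k) N.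

(* Agrees with the conjugate of [tpoly c N z] on [Cmod z = s], where [Cconj z = s^2 / z], but is analytic. *)
Definition tconj (c : nat -> C) (N : nat) (s : R) (z : C) : C :=
  csum (fun k => Cconj (c k) * RtoC (s ^ (2 * k)) * (/ z) ^ k) N.

(** By Parseval, the mean of |tpoly|^2 over the circle of radius [s]. *)
Definition tnorm (c : nat -> C) (N : nat) (s : R) : R :=
  sum_n (fun k => Cmod (c k) ^ 2 * s ^ (2 * k))%R N.

(** The radius [r] of integration is independent of the radius [s] built into [tconj]. Only diagonal
    terms survive, and in these the powers of [r] cancel, so the value depends on [s] alone. *)
Lemma is_RInt_tpoly_conj (c : nat -> C) (N : nat) (r s : R) : (0 < r < 1)%R ->
  is_RInt (fun t => Re (tpoly c N (circ r t) * tconj c N s (circ r t))) 0 (2 * PI) (2 * PI * tnorm c N s)%R.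
Proof.
  intros Hr.
  assert (H := is_RInt_csum
    (fun k t => csum (fun j => (c k * (Cconj (c j) * RtoC (s ^ (2 * j)))) * circ r t ^ k * (/ circ r t) ^ j) N)
    (fun k => sum_n (fun j => (if Nat.eqb k j then 2 * PI * Re (c k * (Cconj (c j) * RtoC (s ^ (2 * j)))) else 0)%R) N)
    0 (2 * PI) N).
  match type of H with ?A -> _ => assert (HA : A) end.
  { intros k. apply (is_RInt_csum (fun j t => (c k * (Cconj (c j) * RtoC (s ^ (2 * j)))) * circ r t ^ k * (/ circ r t) ^ j)).
    intros j. apply is_RInt_circ_monomial, Hr. }
  specialize (H HA).
  replace (2 * PI * tnorm c N s)%R with (sum_n (fun k => sum_n (fun j => (if Nat.eqb k j then 2 * PI * Re (c k * (Cconj (c j) * RtoC (s ^ (2 * j)))) else 0)%R) N) N).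
  - eapply is_RInt_ext; [|exact H]. intros t _. cbv beta. f_equal.
    unfold tpoly, tconj. rewrite Cmult_comm, csum_mult_l. apply sum_n_ext. intros k.
    rewrite Cmult_comm, csum_mult_l. apply sum_n_ext. intros j.
    match goal with |- ?u = ?v => change (@eq C u v) end. ring.
  - unfold tnorm. rewrite <- (sum_n_mult_l (K := R_Ring) (2 * PI)%R).
    apply sum_n_ext_loc. intros k Hk.
    rewrite (sum_n_delta (fun j => 2 * PI * Re (c k * (Cconj (c j) * RtoC (s ^ (2 * j)))))%R k N).
    rewrite (proj2 (Nat.leb_le k N) Hk).
    unfold mult; simpl mult.
    rewrite Cmult_assoc, <- Cmod2_conj, <- RtoC_mult. reflexivity.
Qed.

Lemma C1p_tconj (c : nat -> C) (N : nat) (s : R) : C1p (tconj c N s).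
Proof.
  apply (C1p_csum (fun k z => Cconj (c k) * RtoC (s ^ (2 * k)) * (/ z) ^ k)). intros k.
  apply (C1p_mult (fun _ => Cconj (c k) * RtoC (s ^ (2 * k))) (fun z => (/ z) ^ k)); [apply C1p_const|].
  apply (C1p_pow Cinv), C1p_inv; [apply punctured_neq_0|apply C1p_id].
Qed.

Lemma tconj_circ (c : nat -> C) (N : nat) (s t : R) : (0 < s < 1)%R ->
  tconj c N s (circ s t) = Cconj (tpoly c N (circ s t)).
Proof.
  intros Hs. unfold tconj, tpoly. rewrite csum_conj. apply sum_n_ext. intros k.
  match goal with |- ?u = ?v => change (@eq C u v) end.
  rewrite Cmult_conj, Cpow_conj, <- Cmult_assoc. f_equal.
  rewrite pow_mult, RtoC_pow, <- Cpow_mult_l. f_equal.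
  assert (hz := punctured_neq_0 _ (punctured_circ s t Hs)).
  rewrite <- (Cmod_circ s t) at 1 by lra. rewrite Cmod2_conj. field. exact hz.
Qed.

(** The pole at 0 has order at most [N], so [tconj] is harmless against an error of size
    O(z^(N+1)). *)
Lemma Cmod_tconj_le (c : nat -> C) (N : nat) (s : R) (z : C) :
  punctured z -> (0 < s < 1)%R ->
  (Cmod (tconj c N s z) * Cmod z ^ N <= sum_n (fun k => Cmod (c k)) N)%R.
Proof.
  intros Hz Hs. assert (hz := punctured_neq_0 _ Hz). destruct Hz as [Hz0 Hz1].
  assert (HK : forall K, (K <= N)%nat ->
    (Cmod (tconj c K s z) * Cmod z ^ N <= sum_n (fun k => Cmod (c k)) K)%R).
  2:{ apply HK, Nat.le_refl. }
  assert (Hterm : forall k, (k <= N)%nat ->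
    (Cmod (Cconj (c k) * RtoC (s ^ (2 * k)) * (/ z) ^ k) * Cmod z ^ N <= Cmod (c k))%R).
  { intros k Hk. rewrite !Cmod_mult, Cmod_conj, Cmod_pow, Cmod_inv, Cmod_R by exact hz.
    replace N with (k + (N - k))%nat by lia. rewrite pow_add.
    replace (Cmod (c k) * Rabs (s ^ (2 * k)) * (/ Cmod z) ^ k * (Cmod z ^ k * Cmod z ^ (N - k)))%R
      with (Cmod (c k) * (Rabs (s ^ (2 * k)) * ((/ Cmod z * Cmod z) ^ k * Cmod z ^ (N - k))))%R.
    2:{ rewrite Rpow_mult_distr. ring. }
    rewrite Rinv_l, pow1, Rmult_1_l by lra.
    rewrite <- (Rmult_1_r (Cmod (c k))) at 2.
    apply Rmult_le_compat_l; [apply Cmod_ge_0|].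
    assert (h1 : (0 <= s ^ (2 * k) <= 1)%R).
    { split; [apply pow_le; lra|]. rewrite <- (pow1 (2 * k)). apply pow_incr; lra. }
    assert (h2 : (0 <= Cmod z ^ (N - k) <= 1)%R).
    { split; [apply pow_le; lra|]. rewrite <- (pow1 (N - k)). apply pow_incr; lra. }
    rewrite Rabs_pos_eq by lra. nra. }
  induction K as [|K IH]; intros HK.
  - unfold tconj. rewrite !sum_O. apply Hterm, HK.
  - unfold tconj. rewrite !sum_Sn. change (plus ?x ?y) with (x + y)%R at 2.
    match goal with |- (Cmod (plus ?x ?y) * _ <= _)%R => change (plus x y) with (x + y) end.
    eapply Rle_trans.
    { apply Rmult_le_compat_r; [apply pow_le; lra|apply Cmod_triangle]. }
    rewrite Rmult_plus_distr_r. apply Rplus_le_compat; [apply IH; lia|apply Hterm, HK].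
Qed.

Lemma Cmod_minus_sqr (x y : C) :
  (Cmod (x - y) ^ 2 = Cmod x ^ 2 - 2 * Re (x * Cconj y) + Re (y * Cconj y))%R.
Proof. rewrite !Cmod2_alt. unfold Re, Im; simpl. ring. Qed.

(** On the circle of radius [s] the function [tconj] is the conjugate of p = [tpoly], so the mean of
    [H] there is the inner product of [g] with p. Moving the circle towards 0, where [g] is close to
    p, evaluates it; positivity of |g - p|^2 then gives the bound. *)
Lemma tnorm_le (g : C -> C) (c : nat -> C) (N : nat) (M d s : R) :
  C1p g ->
  (forall z, punctured z -> (Cmod (g z) <= 1)%R) ->
  (0 < d)%R ->
  (forall z, (0 < Cmod z < d)%R -> (Cmod (g z - tpoly c N z) <= M * Cmod z ^ S N)%R) ->
  (0 < s < 1)%R -> (tnorm c N s <= 1)%R.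
Proof.
  intros Hg Hg1 Hd Hjet Hs.
  set (H := fun z => g z * tconj c N s z).
  assert (HH : C1p H) by (apply C1p_mult; [exact Hg|apply C1p_tconj]).
  set (B := tnorm c N s). set (A := sum_n (fun k => Cmod (c k)) N).
  assert (HPI := PI_RGT_0).
  assert (HA : (0 <= A)%R).
  { unfold A. clear. induction N as [|N IH]; [rewrite sum_O; apply Cmod_ge_0|].
    rewrite sum_Sn. apply Rplus_le_le_0_compat; [exact IH|apply Cmod_ge_0]. }
  set (M' := Rmax M 0).
  assert (HM' : (0 <= M')%R) by apply Rmax_r.
  (* Replacing [g] by [tpoly] costs at most M' r^(N+1) times A r^(-N), which is O(r). *)
  assert (Hsmall : forall r, (0 < r < s)%R -> (r < d)%R ->
    (Rabs (mean H r - 2 * PI * B) <= 2 * PI * (M' * A * r))%R).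
  { intros r Hr Hrd. assert (Hr1 : (0 < r < 1)%R) by lra.
    assert (h1 := RInt_correct _ _ _ (ex_RInt_circ H r HH Hr1)).
    assert (h2 := is_RInt_minus _ _ _ _ _ _ h1 (is_RInt_tpoly_conj c N r s Hr1)).
    replace (2 * PI * (M' * A * r))%R with ((2 * PI - 0) * (M' * A * r))%R by ring.
    refine (norm_RInt_le_const _ 0 (2 * PI) _ (M' * A * r)%R _ _ h2); [lra|].
    intros t _. cbv beta. unfold H.
    match goal with |- (norm (minus (Re ?x) (Re ?y)) <= _)%R => change (Rabs (Re (x - y)) <= M' * A * r)%R end.
    eapply Rle_trans; [apply re_le_Cmod|].
    replace (g (circ r t) * tconj c N s (circ r t) - tpoly c N (circ r t) * tconj c N s (circ r t))
      with ((g (circ r t) - tpoly c N (circ r t)) * tconj c N s (circ r t)) by ring.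
    rewrite Cmod_mult.
    assert (hc : Cmod (circ r t) = r) by (apply Cmod_circ; lra).
    assert (k1 := Hjet (circ r t)). rewrite hc in k1. specialize (k1 (conj (proj1 Hr) Hrd)).
    assert (k2 := Cmod_tconj_le c N s _ (punctured_circ r t Hr1) Hs). rewrite hc in k2. fold A in k2.
    assert (k3 := Cmod_ge_0 (tconj c N s (circ r t))).
    assert (hp : (0 < r ^ N)%R) by (apply pow_lt; lra).
    apply Rle_trans with (M' * r ^ S N * Cmod (tconj c N s (circ r t)))%R.
    - apply Rmult_le_compat_r; [exact k3|]. eapply Rle_trans; [exact k1|].
      apply Rmult_le_compat_r; [apply pow_le; lra|apply Rmax_l].
    - replace (M' * r ^ S N * Cmod (tconj c N s (circ r t)))%R
        with (M' * r * (Cmod (tconj c N s (circ r t)) * r ^ N))%R by (simpl; ring).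
      replace (M' * A * r)%R with (M' * r * A)%R by ring.
      apply Rmult_le_compat_l; [apply Rmult_le_pos; lra|exact k2]. }
  (* The mean at [s] equals the mean at every smaller [r], so an O(r) discrepancy forces
     equality. *)
  assert (HmH : mean H s = (2 * PI * B)%R).
  { apply cond_eq. intros eps He.
    set (r := Rmin (Rmin (s / 2) (d / 2)) (eps / (2 * PI * (M' * A) + 1))).
    assert (HK : (0 <= 2 * PI * (M' * A))%R) by (apply Rmult_le_pos; [lra|apply Rmult_le_pos; assumption]).
    assert (r1 : (0 < r)%R).
    { unfold r. repeat apply Rmin_glb_lt; try lra. apply Rdiv_lt_0_compat; lra. }
    assert (r2 : (r <= s / 2)%R) by (unfold r; eapply Rle_trans; [apply Rmin_l|apply Rmin_l]).
    assert (r3 : (r <= d / 2)%R) by (unfold r; eapply Rle_trans; [apply Rmin_l|apply Rmin_r]).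
    assert (r4 : (r <= eps / (2 * PI * (M' * A) + 1))%R) by apply Rmin_r.
    rewrite <- (mean_const H r s HH) by lra.
    eapply Rle_lt_trans; [apply Hsmall; lra|].
    apply Rle_lt_trans with (2 * PI * (M' * A) * (eps / (2 * PI * (M' * A) + 1)))%R.
    - replace (2 * PI * (M' * A * r))%R with (2 * PI * (M' * A) * r)%R by ring.
      apply Rmult_le_compat_l; assumption.
    - apply Rmult_lt_reg_r with (2 * PI * (M' * A) + 1)%R; [lra|].
      replace (2 * PI * (M' * A) * (eps / (2 * PI * (M' * A) + 1)) * (2 * PI * (M' * A) + 1))%R
        with (2 * PI * (M' * A) * eps)%R by (field; lra). lra. }
  assert (i1 : is_RInt (fun _ => 1%R) 0 (2 * PI) (2 * PI)%R).
  { replace (2 * PI)%R with (scal (2 * PI - 0)%R 1%R) at 2 by (unfold scal; simpl; unfold mult; simpl; ring).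
    apply (is_RInt_const (V := R_NormedModule)). }
  assert (i2 := RInt_correct _ _ _ (ex_RInt_circ H s HH Hs)).
  rewrite HmH in i2.
  assert (i3 := is_RInt_tpoly_conj c N s s Hs).
  (* The integrand 1 - 2 Re (g conj p) + |p|^2 is at least |g - p|^2, because |g| <= 1. Its integral
     is 2 pi (1 - 2B + B), whence B <= 1. *)
  assert (i4 := is_RInt_plus _ _ _ _ _ _ (is_RInt_minus _ _ _ _ _ _ i1 (is_RInt_scal _ _ _ 2%R _ i2)) i3).
  assert (i5 : is_RInt (fun _ => 0%R) 0 (2 * PI) 0%R).
  { replace 0%R with (scal (2 * PI - 0)%R 0%R) at 2 by (unfold scal; simpl; unfold mult; simpl; ring).
    apply (is_RInt_const (V := R_NormedModule)). }
  assert (i6 := is_RInt_le _ _ 0 (2 * PI) _ _ ltac:(lra) i5 i4).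
  match type of i6 with ?X -> _ => assert (HX : X) end.
  { intros t _.
    change (0 <= 1 - 2 * Re (g (circ s t) * tconj c N s (circ s t)) + Re (tpoly c N (circ s t) * tconj c N s (circ s t)))%R.
    rewrite tconj_circ by exact Hs.
    assert (h := Cmod_minus_sqr (g (circ s t)) (tpoly c N (circ s t))).
    assert (h1 := Hg1 _ (punctured_circ s t Hs)). assert (h2 := Cmod_ge_0 (g (circ s t))).
    assert (h3 := pow2_ge_0 (Cmod (g (circ s t) - tpoly c N (circ s t)))).
    nra. }
  specialize (i6 HX). fold B in i6.
  change (0 <= 2 * PI - 2 * (2 * PI * B) + 2 * PI * B)%R in i6. nra.
Qed.

(** The case s -> 1 of [tnorm_le], where every factor s^(2k) is at least s^(2N). *)
Lemma bessel (g : C -> C) (c : nat -> C) (N : nat) (M d : R) :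
  C1p g ->
  (forall z, punctured z -> (Cmod (g z) <= 1)%R) ->
  (0 < d)%R ->
  (forall z, (0 < Cmod z < d)%R -> (Cmod (g z - tpoly c N z) <= M * Cmod z ^ S N)%R) ->
  (sum_n (fun k => Cmod (c k) ^ 2) N <= 1)%R.
Proof.
  intros Hg Hg1 Hd Hjet.
  set (A := sum_n (fun k => Cmod (c k) ^ 2)%R N).
  assert (HA : forall s, (0 < s < 1)%R -> (s ^ (2 * N) * A <= 1)%R).
  { intros s Hs. eapply Rle_trans; [|apply (tnorm_le g c N M d s); assumption].
    unfold A, tnorm.
    assert (HK : forall K, (K <= N)%nat -> (s ^ (2 * N) * sum_n (fun k => Cmod (c k) ^ 2)%R K
       <= sum_n (fun k => Cmod (c k) ^ 2 * s ^ (2 * k))%R K)%R).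
    2:{ apply HK, Nat.le_refl. }
    assert (Hterm : forall k, (k <= N)%nat -> (s ^ (2 * N) * Cmod (c k) ^ 2 <= Cmod (c k) ^ 2 * s ^ (2 * k))%R).
    { intros k Hk. rewrite Rmult_comm. apply Rmult_le_compat_l; [apply pow2_ge_0|].
      replace (2 * N)%nat with (2 * k + 2 * (N - k))%nat by lia. rewrite pow_add.
      rewrite <- (Rmult_1_r (s ^ (2 * k))) at 2. apply Rmult_le_compat_l; [apply pow_le; lra|].
      rewrite <- (pow1 (2 * (N - k))). apply pow_incr; lra. }
    induction K as [|K IH]; intros HK.
    - rewrite !sum_O. apply Hterm, HK.
    - rewrite !sum_Sn. unfold plus; simpl AbelianMonoid.plus; cbv beta.
      rewrite Rmult_plus_distr_l. apply Rplus_le_compat; [apply IH; lia|apply Hterm, HK]. }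
  destruct (Rle_lt_dec A 1) as [h|h]; [exact h|exfalso].
  set (n := INR (2 * N)). assert (Hn : (0 <= n)%R) by apply pos_INR.
  (* Chosen so that n e A <= (A - 1)/2. By Bernoulli, (1 - e)^(2N) A is then at least (A + 1)/2 > 1,
     a contradiction. *)
  set (e := ((A - 1) / (2 * A * (n + 1)))%R).
  assert (He : (e * (2 * A * (n + 1)) = A - 1)%R) by (unfold e; field; lra).
  assert (He0 : (0 < e)%R) by (unfold e; apply Rdiv_lt_0_compat; nra).
  assert (HK : (2 * A <= 2 * A * (n + 1))%R) by nra.
  assert (He1 : (e < 1)%R).
  { apply Rnot_le_lt; intros He1. nra. }
  specialize (HA (1 - e)%R ltac:(lra)).
  assert (h2 := one_minus_pow_ge e (2 * N) ltac:(lra)). fold n in h2.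
  assert (h3 : ((1 - n * e) * A <= 1)%R).
  { eapply Rle_trans; [|exact HA]. apply Rmult_le_compat_r; lra. }
  assert (h4 : (n * e * A <= (A - 1) / 2)%R) by nra.
  lra.
Qed.

(** * The upper bound *)

Lemma ln_2_lt_1 : (ln 2 < 1)%R.
Proof.
  rewrite <- (ln_exp 1). apply ln_increasing; [lra|].
  assert (h := exp_ineq1 1 ltac:(lra)). lra.
Qed.

(** The real part is 1 - ln |1 + y| and |1 + y| < 2. As ln 2 < 1, the denominator in the definition
    of the class never vanishes and is even bounded away from 0. *)
Lemma Re_one_minus_Clog (y : C) : unit_disc y -> (1 - ln 2 <= Re (1 - Clog (1 + y)))%R.
Proof.
  intros Hy. unfold Re, Clog; simpl.
  assert (h1 : (0 < Cmod (1 + y))%R) by (apply Cmod_gt_0, unit_disc_1_plus, Hy).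
  assert (h2 : (Cmod (1 + y) <= 2)%R).
  { eapply Rle_trans; [apply Cmod_triangle|]. rewrite Cmod_1. unfold unit_disc in Hy. lra. }
  assert (h3 : (ln (Cmod (1 + y)) <= ln 2)%R) by (apply ln_le; assumption).
  lra.
Qed.

Lemma Cmod_one_minus_Clog (y : C) : unit_disc y -> (1 - ln 2 <= Cmod (1 - Clog (1 + y)))%R.
Proof.
  intros Hy. eapply Rle_trans; [apply Re_one_minus_Clog, Hy|].
  eapply Rle_trans; [apply Rle_abs|apply re_le_Cmod].
Qed.

Lemma one_minus_Clog_neq_0 (y : C) : unit_disc y -> 1 - Clog (1 + y) <> 0.
Proof.
  intros Hy. apply Cmod_gt_0. assert (h := Cmod_one_minus_Clog y Hy). assert (k := ln_2_lt_1). lra.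
Qed.

Lemma cderiv_Clog_1_plus (y : C) :
  unit_disc y -> cderiv (fun y => Clog (1 + y)) y (/ (1 + y)).
Proof.
  intros Hy. destruct (taylor_disc_deriv _ _ Clog_taylor) as [T [HT HD]].
  rewrite <- (geometric_taylor T HT y Hy). apply HD, Hy.
Qed.

Lemma punctured_ball (z : C) : punctured z ->
  exists r, (0 < r)%R /\ forall y, (Cmod (y - z) < r)%R -> punctured y.
Proof.
  intros [h0 h1]. exists (Rmin (Cmod z) (1 - Cmod z)); split; [apply Rmin_glb_lt; lra|].
  intros y Hy.
  assert (k1 := Rlt_le_trans _ _ _ Hy (Rmin_l _ _)).
  assert (k2 := Rlt_le_trans _ _ _ Hy (Rmin_r _ _)).
  assert (k3 := Cmod_triangle_rev z y). rewrite Cmod_minus_sym in k3.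
  assert (k4 := Cmod_triangle_rev y z). unfold punctured. lra.
Qed.

Lemma C1p_taylor_disc (f : C -> C) (a : nat -> C) : taylor_disc f a -> C1p f.
Proof.
  intros Hf. destruct (taylor_disc_deriv _ _ Hf) as [f1 [Hf1 Hd]].
  destruct (taylor_disc_deriv _ _ Hf1) as [f2 [_ Hd1]].
  exists f1; intros z [_ Hz]. split; [apply Hd, Hz|eapply cderiv_ccont, Hd1, Hz].
Qed.

(* Differentiating [Clog (1 + w z) = V z] gives [w' = (1 + w) V']. *)
Lemma C1p_of_Clog (w V : C -> C) :
  analytic_disc w -> (forall z, unit_disc z -> unit_disc (w z)) ->
  C1p V -> (forall z, punctured z -> Clog (1 + w z) = V z) -> C1p w.
Proof.
  intros Hw Hwd [V' HV] E. exists (fun z => (1 + w z) * V' z); intros z Hz.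
  assert (Hex : exists l : C, cderiv w z l) by exact (Hw z (proj2 Hz)).
  destruct Hex as [w' Hw'].
  destruct (HV z Hz) as [HV1 HV2].
  assert (hw := Hwd z (proj2 Hz)).
  assert (h1 := cderiv_comp (fun y => Clog (1 + y)) w z _ _ (cderiv_Clog_1_plus _ hw) Hw').
  destruct (punctured_ball z Hz) as [r [Hr Hb]].
  assert (h2 : cderiv (fun y => Clog (1 + w y)) z (V' z)).
  { apply (cderiv_ext_near V _ z _ r Hr); [|exact HV1].
    intros y Hy. symmetry. apply E, Hb, Hy. }
  assert (h3 := cderiv_unique _ _ _ _ h1 h2).
  assert (hn := unit_disc_1_plus _ hw).
  split.
  - replace ((1 + w z) * V' z) with w' by (rewrite <- h3; field; exact hn). exact Hw'.
  - apply ccont_mult; [|exact HV2]. apply ccont_plus; [apply ccont_const|].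
    eapply cderiv_ccont, Hw'.
Qed.

(** * Expansions at the origin with error estimates *)

Definition bigO (n : nat) (u : C -> C) : Prop :=
  exists M d : R, (0 <= M)%R /\ (0 < d)%R /\
    forall z, (Cmod z < d)%R -> (Cmod (u z) <= M * Cmod z ^ n)%R.

Lemma bigO_ext_near (n : nat) (u v : C -> C) (r : R) : (0 < r)%R ->
  (forall z, (Cmod z < r)%R -> u z = v z) -> bigO n u -> bigO n v.
Proof.
  intros Hr E [M [d [HM [Hd H]]]]. exists M, (Rmin d r).
  split; [exact HM|]. split; [apply Rmin_glb_lt; assumption|].
  intros z Hz. rewrite <- E by (eapply Rlt_le_trans; [exact Hz|apply Rmin_r]).
  apply H. eapply Rlt_le_trans; [exact Hz|apply Rmin_l].
Qed.

Lemma bigO_ext (n : nat) (u v : C -> C) : (forall z, u z = v z) -> bigO n u -> bigO n v.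
Proof. intros E. apply (bigO_ext_near n u v 1 Rlt_0_1). intros z _; apply E. Qed.

Lemma bigO_plus (n : nat) (u v : C -> C) : bigO n u -> bigO n v -> bigO n (fun z => u z + v z).
Proof.
  intros [M [d [HM [Hd H]]]] [M' [d' [HM' [Hd' H']]]]. exists (M + M')%R, (Rmin d d').
  split; [lra|]. split; [apply Rmin_glb_lt; assumption|].
  intros z Hz.
  specialize (H z (Rlt_le_trans _ _ _ Hz (Rmin_l _ _))).
  specialize (H' z (Rlt_le_trans _ _ _ Hz (Rmin_r _ _))).
  eapply Rle_trans; [apply Cmod_triangle|]. lra.
Qed.

Lemma bigO_mult (n m : nat) (u v : C -> C) :
  bigO n u -> bigO m v -> bigO (n + m) (fun z => u z * v z).
Proof.
  intros [M [d [HM [Hd H]]]] [M' [d' [HM' [Hd' H']]]]. exists (M * M')%R, (Rmin d d').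
  split; [nra|]. split; [apply Rmin_glb_lt; assumption|].
  intros z Hz.
  specialize (H z (Rlt_le_trans _ _ _ Hz (Rmin_l _ _))).
  specialize (H' z (Rlt_le_trans _ _ _ Hz (Rmin_r _ _))).
  rewrite Cmod_mult, pow_add.
  replace (M * M' * (Cmod z ^ n * Cmod z ^ m))%R with ((M * Cmod z ^ n) * (M' * Cmod z ^ m))%R by ring.
  apply Rmult_le_compat; try apply Cmod_ge_0; assumption.
Qed.

Lemma bigO_const (c : C) : bigO 0 (fun _ => c).
Proof.
  exists (Cmod c), 1%R. split; [apply Cmod_ge_0|]. split; [lra|]. intros z _. simpl. lra.
Qed.

Lemma bigO_id : bigO 1 (fun z => z).
Proof. exists 1%R, 1%R. repeat split; try lra. intros z _. simpl. lra. Qed.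

Lemma bigO_pow (n : nat) : bigO n (fun z => z ^ n).
Proof.
  exists 1%R, 1%R. repeat split; try lra. intros z _. rewrite Cmod_pow. lra.
Qed.

Lemma bigO_le (m n : nat) (u : C -> C) : (m <= n)%nat -> bigO n u -> bigO m u.
Proof.
  intros Hmn [M [d [HM [Hd H]]]]. exists M, (Rmin d 1).
  split; [exact HM|]. split; [apply Rmin_glb_lt; lra|].
  intros z Hz. eapply Rle_trans; [apply H; eapply Rlt_le_trans; [exact Hz|apply Rmin_l]|].
  assert (h := Rlt_le_trans _ _ _ Hz (Rmin_r _ _)). assert (h0 := Cmod_ge_0 z).
  apply Rmult_le_compat_l; [exact HM|]. replace n with (m + (n - m))%nat by lia.
  rewrite pow_add. rewrite <- (Rmult_1_r (Cmod z ^ m)) at 2.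
  apply Rmult_le_compat_l; [apply pow_le, h0|].
  rewrite <- (pow1 (n - m)). apply pow_incr; lra.
Qed.

Definition poly4 (c0 c1 c2 c3 c4 z : C) : C :=
  c0 + c1 * z + c2 * z ^ 2 + c3 * z ^ 3 + c4 * z ^ 4.

Definition jet4 (u : C -> C) (c0 c1 c2 c3 c4 : C) : Prop :=
  bigO 5 (fun z => u z - poly4 c0 c1 c2 c3 c4 z).

Lemma bigO_poly4 (c0 c1 c2 c3 c4 : C) : bigO 0 (poly4 c0 c1 c2 c3 c4).
Proof.
  assert (H : forall c n, bigO 0 (fun z => c * z ^ n)).
  { intros c n. apply (bigO_mult 0 0 (fun _ => c)); [apply bigO_const|].
    apply (bigO_le 0 n); [lia|apply bigO_pow]. }
  unfold poly4. repeat apply bigO_plus; try apply H; [apply bigO_const|].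
  apply (bigO_mult 0 0 (fun _ => c1)); [apply bigO_const|]. apply (bigO_le 0 1); [lia|apply bigO_id].
Qed.

Lemma jet4_bigO (u : C -> C) (c0 c1 c2 c3 c4 : C) : jet4 u c0 c1 c2 c3 c4 -> bigO 0 u.
Proof.
  intros H. apply (bigO_ext 0 (fun z => (u z - poly4 c0 c1 c2 c3 c4 z) + poly4 c0 c1 c2 c3 c4 z)).
  - intros z; ring.
  - apply bigO_plus; [eapply bigO_le; [|exact H]; lia|apply bigO_poly4].
Qed.

Lemma jet4_poly4 (c0 c1 c2 c3 c4 : C) : jet4 (poly4 c0 c1 c2 c3 c4) c0 c1 c2 c3 c4.
Proof.
  exists 0%R, 1%R. repeat split; try lra. intros z _.
  replace (_ - _) with (RtoC 0) by ring. rewrite Cmod_0. lra.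
Qed.

Lemma jet4_linear (k : C) (u v : C -> C) (c0 c1 c2 c3 c4 d0 d1 d2 d3 d4 : C) :
  jet4 u c0 c1 c2 c3 c4 -> jet4 v d0 d1 d2 d3 d4 ->
  jet4 (fun z => u z + k * v z) (c0 + k * d0) (c1 + k * d1) (c2 + k * d2) (c3 + k * d3) (c4 + k * d4).
Proof.
  intros H1 H2.
  assert (H3 := bigO_plus _ _ _ H1 (bigO_mult 0 5 _ _ (bigO_const k) H2)).
  eapply bigO_ext; [|exact H3]. intros z; unfold poly4; cbv beta; ring.
Qed.

Lemma jet4_mult (u v : C -> C) (c0 c1 c2 c3 c4 d0 d1 d2 d3 d4 : C) :
  jet4 u c0 c1 c2 c3 c4 -> jet4 v d0 d1 d2 d3 d4 ->
  jet4 (fun z => u z * v z) (c0 * d0) (c0 * d1 + c1 * d0) (c0 * d2 + c1 * d1 + c2 * d0)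
    (c0 * d3 + c1 * d2 + c2 * d1 + c3 * d0) (c0 * d4 + c1 * d3 + c2 * d2 + c3 * d1 + c4 * d0).
Proof.
  intros H1 H2.
  assert (H3 := bigO_mult 5 0 _ _ H1 (jet4_bigO _ _ _ _ _ _ H2)).
  assert (H4 := bigO_mult 0 5 _ _ (bigO_poly4 c0 c1 c2 c3 c4) H2).
  (* The terms of degree 5 to 8 in the product of the two polynomials, written as z^5 times a
     cubic. *)
  assert (H5 := bigO_mult 5 0 _ _ (bigO_pow 5) (bigO_poly4 (c1 * d4 + c2 * d3 + c3 * d2 + c4 * d1)
     (c2 * d4 + c3 * d3 + c4 * d2) (c3 * d4 + c4 * d3) (c4 * d4) 0)).
  eapply bigO_ext; [|exact (bigO_plus _ _ _ (bigO_plus _ _ _ H3 H4) H5)].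
  intros z; unfold poly4; cbv beta; ring.
Qed.

Lemma taylor_disc_bigO (f : C -> C) (a : nat -> C) : taylor_disc f a -> bigO 0 f.
Proof.
  intros Hf. destruct (taylor_disc_bounded f a (1 / 2) Hf ltac:(lra)) as [M HM].
  exists M, (1 / 2)%R. split.
  - eapply Rle_trans; [apply (Cmod_ge_0 (f 0))|]. apply HM. rewrite Cmod_0; lra.
  - split; [lra|]. intros z Hz. simpl. rewrite Rmult_1_r. apply HM; lra.
Qed.

Lemma taylor_disc_split5 (f : C -> C) (a : nat -> C) :
  taylor_disc f a -> exists h, bigO 0 h /\ forall z, unit_disc z ->
    f z = poly4 (a 0%nat) (a 1%nat) (a 2%nat) (a 3%nat) (a 4%nat) z + z ^ 5 * h z.
Proof.
  intros Hf.
  destruct (taylor_disc_shift _ _ Hf) as [h1 [Hh1 E1]].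
  destruct (taylor_disc_shift _ _ Hh1) as [h2 [Hh2 E2]].
  destruct (taylor_disc_shift _ _ Hh2) as [h3 [Hh3 E3]].
  destruct (taylor_disc_shift _ _ Hh3) as [h4 [Hh4 E4]].
  destruct (taylor_disc_shift _ _ Hh4) as [h5 [Hh5 E5]].
  exists h5; split; [eapply taylor_disc_bigO, Hh5|].
  intros z Hz. rewrite E1, E2, E3, E4, E5 by exact Hz. unfold poly4. ring.
Qed.

Lemma taylor_disc_jet4 (f : C -> C) (a : nat -> C) :
  taylor_disc f a -> jet4 f (a 0%nat) (a 1%nat) (a 2%nat) (a 3%nat) (a 4%nat).
Proof.
  intros Hf. destruct (taylor_disc_split5 _ _ Hf) as [h [Hh E]].
  eapply (bigO_ext_near 5 _ _ 1 Rlt_0_1); [|exact (bigO_mult 5 0 _ _ (bigO_pow 5) Hh)].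
  intros z Hz. rewrite (E z Hz). cbv beta. ring.
Qed.

(* The jets of [w] are read off [f1 (1 - log (1 + w)) = g] because
   [y -> log (1 + y)] has derivative 1 at 0 and [f1 0 = 1]. *)
Lemma jet4_of_Clog (w f1 g P : C -> C) :
  bigO 1 w -> bigO 1 P -> bigO 1 (fun z => f1 z - 1) ->
  (forall z, unit_disc z -> unit_disc (w z)) ->
  (forall z, unit_disc z -> f1 z * (1 - Clog (1 + w z)) = g z) ->
  bigO 5 (fun z => f1 z * (1 - (P z - P z ^ 2 / 2 + P z ^ 3 / 3 - P z ^ 4 / 4)) - g z) ->
  bigO 5 (fun z => w z - P z).
Proof.
  intros Hw HP Hf1 Hwd E HPg.
  destruct (taylor_disc_split5 _ _ Clog_taylor) as [h [Hh Eh]].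
  assert (EL : forall y, unit_disc y -> Clog (1 + y) = y - y ^ 2 / 2 + y ^ 3 / 3 - y ^ 4 / 4 + y ^ 5 * h y).
  { intros y Hy. rewrite (Eh y Hy). unfold poly4, lcoef.
    replace ((-1) ^ 0 / INR 1)%R with 1%R by (simpl; field).
    replace ((-1) ^ 1 / INR 2)%R with (- / 2)%R by (simpl; field).
    replace ((-1) ^ 2 / INR 3)%R with (/ 3)%R by (simpl; field).
    replace ((-1) ^ 3 / INR 4)%R with (- / 4)%R by (simpl; field).
    rewrite !RtoC_opp, !RtoC_inv by lra. field. }
  assert (Hhw : bigO 0 (fun z => h (w z))).
  { destruct Hw as [M [d [HM [Hd H]]]]. destruct Hh as [M' [d' [HM' [Hd' H']]]].
    exists M', (Rmin d (d' / (M + 1))). split; [exact HM'|].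
    assert (Hq : (0 < d' / (M + 1))%R) by (apply Rdiv_lt_0_compat; lra).
    split; [apply Rmin_glb_lt; assumption|]. intros z Hz.
    simpl. specialize (H' (w z)). simpl in H'. apply H'.
    eapply Rle_lt_trans; [apply H; eapply Rlt_le_trans; [exact Hz|apply Rmin_l]|].
    assert (hz := Rlt_le_trans _ _ _ Hz (Rmin_r _ _)). assert (hz0 := Cmod_ge_0 z).
    simpl. rewrite Rmult_1_r.
    apply Rle_lt_trans with ((M + 1) * Cmod z)%R; [nra|].
    apply Rmult_lt_reg_r with (/ (M + 1))%R; [apply Rinv_0_lt_compat; lra|].
    replace ((M + 1) * Cmod z * / (M + 1))%R with (Cmod z) by (field; lra). exact hz. }
  assert (HOf1 : bigO 0 f1).
  { apply (bigO_ext 0 (fun z => (f1 z - 1) + 1)); [intros; ring|].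
    apply bigO_plus; [eapply bigO_le; [|exact Hf1]; lia|apply bigO_const]. }
  assert (Hpow : forall n u, bigO 1 u -> bigO n (fun z => u z ^ n)).
  { intros n u Hu. induction n as [|n IH]; [apply (bigO_const 1)|].
    apply (bigO_mult 1 n u); assumption. }
  (* With l(y) = y - y^2/2 + y^3/3 - y^4/4, the product of [w - P] and [q] is f1 (l(w) - l(P)). *)
  set (q := fun z => f1 z * (1 - (w z + P z) / 2 + (w z ^ 2 + w z * P z + P z ^ 2) / 3
     - (w z ^ 3 + w z ^ 2 * P z + w z * P z ^ 2 + P z ^ 3) / 4)).
  assert (Hq : bigO 1 (fun z => q z - 1)).
  { assert (K : bigO 1 (fun z => - (w z + P z) / 2 + (w z ^ 2 + w z * P z + P z ^ 2) / 3
     - (w z ^ 3 + w z ^ 2 * P z + w z * P z ^ 2 + P z ^ 3) / 4)).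
    { assert (T : forall c i j, (1 <= i + j)%nat -> bigO 1 (fun z => c * (w z ^ i * P z ^ j))).
      { intros c i j Hij. apply (bigO_mult 0 1 (fun _ => c)); [apply bigO_const|].
        apply (bigO_le 1 (i + j)); [exact Hij|]. apply bigO_mult; apply Hpow; assumption. }
      eapply bigO_ext; [|exact (bigO_plus _ _ _ (bigO_plus _ _ _ (T (-/2) 1%nat 0%nat ltac:(lia)) (T (-/2) 0%nat 1%nat ltac:(lia)))
        (bigO_plus _ _ _ (bigO_plus _ _ _ (T (/3) 2%nat 0%nat ltac:(lia)) (bigO_plus _ _ _ (T (/3) 1%nat 1%nat ltac:(lia)) (T (/3) 0%nat 2%nat ltac:(lia))))
          (bigO_plus _ _ _ (bigO_plus _ _ _ (T (-/4) 3%nat 0%nat ltac:(lia)) (T (-/4) 2%nat 1%nat ltac:(lia)))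
             (bigO_plus _ _ _ (T (-/4) 1%nat 2%nat ltac:(lia)) (T (-/4) 0%nat 3%nat ltac:(lia))))))].
      intros z; cbv beta; field. }
    eapply bigO_ext; [|exact (bigO_plus 1 _ _ Hf1 (bigO_mult 0 1 _ _ HOf1 K))].
    intros z; unfold q; cbv beta; field. }
  assert (Hprod : bigO 5 (fun z => (w z - P z) * q z)).
  { assert (K := bigO_mult 0 5 _ _ HOf1 (bigO_mult 5 0 _ _ (Hpow 5%nat w Hw) Hhw)).
    assert (K2 := bigO_plus 5 _ _ HPg (bigO_mult 0 5 _ _ (bigO_const (-(1))) K)).
    eapply (bigO_ext_near 5 _ _ 1 Rlt_0_1); [|exact K2].
    intros z Hz. cbv beta. rewrite <- (E z Hz). rewrite (EL (w z)) by (apply Hwd, Hz).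
    unfold q. field. }
  destruct Hq as [M [d [HM [Hd H]]]]. destruct Hprod as [M' [d' [HM' [Hd' H']]]].
  (* The last radius gives |q - 1| <= 1/2, so |q| >= 1/2 and dividing by [q] at most doubles the
     constant. *)
  exists (2 * M')%R, (Rmin d' (Rmin d (/ (2 * (M + 1))))). split; [lra|].
  split. { repeat apply Rmin_glb_lt; try assumption. apply Rinv_0_lt_compat; lra. }
  intros z Hz.
  assert (h1 := Rlt_le_trans _ _ _ Hz (Rmin_l _ _)).
  assert (h2 := Rlt_le_trans _ _ _ Hz (Rmin_r _ _)).
  assert (h3 := Rlt_le_trans _ _ _ h2 (Rmin_l _ _)).
  assert (h4 := Rlt_le_trans _ _ _ h2 (Rmin_r _ _)).
  specialize (H z h3). specialize (H' z h1). simpl in H. rewrite Rmult_1_r in H.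
  rewrite Cmod_mult in H'.
  assert (hz0 := Cmod_ge_0 z).
  assert (h5 : (M * Cmod z <= 1 / 2)%R).
  { apply Rle_trans with ((M + 1) * / (2 * (M + 1)))%R; [|apply Req_le; field; lra].
    apply Rmult_le_compat; lra. }
  assert (h6 := Cmod_triangle_rev 1 (q z)). rewrite Cmod_1, Cmod_minus_sym in h6.
  assert (h7 := Cmod_ge_0 (w z - P z)). nra.
Qed.

(** * The estimate of the Hankel determinant *)

Lemma hankel_real_bound (p q r v : R) :
  (0 <= p)%R -> (0 <= q)%R -> (0 <= r)%R -> (0 <= v)%R ->
  (p ^ 2 + q ^ 2 + r ^ 2 + v ^ 2 <= 1)%R ->
  (37 / 10368 * p ^ 6 + 17 / 1728 * (p ^ 4 * q) + 1 / 432 * (p ^ 3 * r) + 1 / 144 * (p ^ 2 * q ^ 2)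
   + 1 / 16 * (p ^ 2 * v) + 5 / 72 * (p * q * r) + 1 / 8 * (q * v) + 1 / 9 * r ^ 2 <= 1 / 9)%R.
Proof.
  intros Hp Hq Hr Hv H.
  assert (p1 : (p <= 1)%R) by nra. assert (q1 : (q <= 1)%R) by nra.
  assert (r1 : (r <= 1)%R) by nra. assert (v1 : (v <= 1)%R) by nra.
  assert (pp : (0 <= p ^ 2 <= 1)%R) by nra.
  assert (p4 : (p ^ 4 <= p ^ 2)%R) by (replace (p ^ 4)%R with (p ^ 2 * p ^ 2)%R by ring; nra).
  assert (p40 : (0 <= p ^ 4)%R) by (replace (p ^ 4)%R with (p ^ 2 * p ^ 2)%R by ring; nra).
  assert (t1 : (p ^ 6 <= p ^ 2)%R) by (replace (p ^ 6)%R with (p ^ 4 * p ^ 2)%R by ring; nra).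
  assert (t2 : (p ^ 4 * q <= p ^ 2)%R) by nra.
  assert (t3 : (p ^ 3 * r <= p ^ 2)%R).
  { replace (p ^ 3 * r)%R with (p ^ 2 * (p * r))%R by ring. assert (p * r <= 1)%R by nra. nra. }
  assert (t4 : (p ^ 2 * q ^ 2 <= q ^ 2)%R) by nra.
  assert (t5 : (p ^ 2 * v <= p ^ 2)%R) by nra.
  (* Any weights with product 1/4 would do in this form of the inequality of the means. The weight
     3/5 is the largest that q^2 can carry, as 1/144 + 1/16 + (5/72)(3/5) = 1/9. *)
  assert (t6 : (p * q * r <= 5 / 12 * p ^ 2 + 3 / 5 * q ^ 2)%R).
  { apply Rle_trans with (p * q)%R; [assert (0 <= p * q)%R by nra; nra|].
    assert (h := pow2_ge_0 (5 * p - 6 * q)). nra. }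
  assert (t7 : (q * v <= (q ^ 2 + v ^ 2) / 2)%R) by (assert (h := pow2_ge_0 (q - v)); nra).
  (* In total p^2 receives 1111/10368 < 1/9, q^2 and r^2 receive exactly 1/9 each, and v^2 receives
     1/16. *)
  nra.
Qed.

(** The signs are kept inside the real coefficients, so that the expression is a pure sum and all
    its terms are estimated alike. *)
Lemma hankel_bound (c1 c2 c3 c4 : C) :
  (Cmod c1 ^ 2 + Cmod c2 ^ 2 + Cmod c3 ^ 2 + Cmod c4 ^ 2 <= 1)%R ->
  (Cmod (RtoC (37 / 10368) * c1 ^ 6 + RtoC (- (17 / 1728)) * (c1 ^ 4 * c2) + RtoC (1 / 432) * (c1 ^ 3 * c3)
     + RtoC (- (1 / 144)) * (c1 ^ 2 * c2 ^ 2) + RtoC (- (1 / 16)) * (c1 ^ 2 * c4)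
     + RtoC (5 / 72) * (c1 * c2 * c3) + RtoC (1 / 8) * (c2 * c4) + RtoC (- (1 / 9)) * c3 ^ 2) <= 1 / 9)%R.
Proof.
  intros H. eapply Rle_trans; [|apply (hankel_real_bound (Cmod c1) (Cmod c2) (Cmod c3) (Cmod c4)); try apply Cmod_ge_0; exact H].
  assert (T : forall (x y : C) (u v : R), (Cmod x <= u)%R -> (Cmod y <= v)%R -> (Cmod (x + y) <= u + v)%R).
  { intros x y u v Hx Hy. eapply Rle_trans; [apply Cmod_triangle|lra]. }
  assert (U : forall (k l : R) (x : C), Rabs k = l -> (Cmod (RtoC k * x) <= l * Cmod x)%R).
  { intros k l x Hk. rewrite Cmod_mult, Cmod_R, Hk. lra. }
  rewrite <- !Cmod_pow, <- !Cmod_mult.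
  repeat apply T; apply U; rewrite ?Rabs_Ropp; apply Rabs_pos_eq; lra.
Qed.

(** The four relations result from comparing the coefficients of z, ..., z^4 in f' (1 - log (1 + w))
    = f/z. *)
Lemma H31_schwarz (a : nat -> C) (c1 c2 c3 c4 : C) :
  a 2%nat = c1 -> a 3%nat = c2 / 2 + 3 / 4 * c1 ^ 2 ->
  a 4%nat = c3 / 3 + 5 / 6 * (c1 * c2) + 19 / 36 * c1 ^ 3 ->
  a 5%nat = c4 / 4 + 101 / 288 * c1 ^ 4 + 23 / 24 * (c1 ^ 2 * c2) + 7 / 12 * (c1 * c3) + c2 ^ 2 / 4 ->
  H31 a = RtoC (37 / 10368) * c1 ^ 6 + RtoC (- (17 / 1728)) * (c1 ^ 4 * c2) + RtoC (1 / 432) * (c1 ^ 3 * c3)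
     + RtoC (- (1 / 144)) * (c1 ^ 2 * c2 ^ 2) + RtoC (- (1 / 16)) * (c1 ^ 2 * c4)
     + RtoC (5 / 72) * (c1 * c2 * c3) + RtoC (1 / 8) * (c2 * c4) + RtoC (- (1 / 9)) * c3 ^ 2.
Proof.
  intros E2 E3 E4 E5. rewrite H31_expand, E2, E3, E4, E5.
  rewrite !RtoC_opp, !RtoC_div by lra. field.
Qed.

Lemma H31_le (f : C -> C) (a : nat -> C) :
  S_star_B f -> taylor_disc f a -> (Cmod (H31 a) <= 1 / 9)%R.
Proof.
  intros [[Hfa [Hf0 Hf1]] [Hfnz [w [Hwa [Hw0 [Hwd Hsub]]]]]] Hf.
  assert (D0 : unit_disc 0) by (unfold unit_disc; rewrite Cmod_0; lra).
  assert (a0 : a 0%nat = 0) by (rewrite <- (taylor_disc_0 f a Hf); exact Hf0).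
  destruct (taylor_disc_deriv f a Hf) as [f1 [Tf1 Df1]].
  assert (a1 : a 1%nat = 1).
  { assert (h := taylor_disc_0 f1 _ Tf1). rewrite <- (is_C_derive_unique f 0 _ (Df1 0 D0)), Hf1 in h.
    unfold dcoef in h. simpl in h. rewrite h. ring. }
  destruct (taylor_disc_shift f a Hf) as [g [Tg Eg]].
  assert (Efg : forall z, unit_disc z -> f z = z * g z) by (intros z Hz; rewrite (Eg z Hz), a0; ring).
  (* The subordination cleared of denominators. At 0 the identity is checked on the constant
     coefficients. *)
  assert (E : forall z, unit_disc z -> f1 z * (1 - Clog (1 + w z)) = g z).
  { intros z Hz. specialize (Hsub z Hz). unfold log_quotient in Hsub.
    destruct (Ceq_dec z 0) as [->|Hz0].
    - rewrite Hw0. rewrite (taylor_disc_0 _ _ Clog_taylor), (taylor_disc_0 _ _ Tf1), (taylor_disc_0 _ _ Tg).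
      unfold dcoef, lcoef. simpl. rewrite a1. ring.
    - rewrite (is_C_derive_unique f z _ (Df1 z Hz)) in Hsub.
      assert (hn := one_minus_Clog_neq_0 _ (Hwd z Hz)).
      assert (hf := Hfnz z Hz Hz0). rewrite (Efg z Hz) in Hsub, hf.
      assert (hg : g z <> 0) by (intros K; apply hf; rewrite K; ring).
      set (L := 1 - Clog (1 + w z)) in *.
      replace (f1 z * L) with ((z * f1 z / (z * g z)) * (g z * L)) by (field; split; assumption).
      rewrite Hsub. field. exact hn. }
  assert (Hgnz : forall z, punctured z -> g z <> 0).
  { intros z Hz K. apply (Hfnz z (proj2 Hz) (punctured_neq_0 z Hz)).
    rewrite (Efg z (proj2 Hz)), K. ring. }
  (* By [E], a zero of [f1] would be a zero of [g]. *)
  assert (Hf1nz : forall z, punctured z -> f1 z <> 0).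
  { intros z Hz K. apply (Hgnz z Hz). rewrite <- (E z (proj2 Hz)), K. ring. }
  assert (Cw : C1p w).
  { apply (C1p_of_Clog w (fun z => 1 + (-(1)) * (g z * / f1 z))); try assumption.
    - apply (C1p_plus (fun _ => RtoC 1)); [apply C1p_const|].
      apply (C1p_mult (fun _ => -(1))); [apply C1p_const|].
      apply C1p_mult; [eapply C1p_taylor_disc, Tg|].
      apply C1p_inv; [exact Hf1nz|eapply C1p_taylor_disc, Tf1].
    - intros z Hz. rewrite <- (E z (proj2 Hz)). field. apply Hf1nz, Hz. }
  (* These solve the coefficient relations for the unknown expansion of [w]. That they do describe
     [w] near 0 is proved only in [HwP]. *)
  set (c1 := a 2%nat). set (c2 := 2 * a 3%nat - 3 / 2 * c1 ^ 2).
  set (c3 := 3 * a 4%nat - 5 / 2 * (c1 * c2) - 19 / 12 * c1 ^ 3).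
  set (c4 := 4 * a 5%nat - 101 / 72 * c1 ^ 4 - 23 / 6 * (c1 ^ 2 * c2) - 7 / 3 * (c1 * c3) - c2 ^ 2).
  assert (e2 : a 2%nat = c1) by reflexivity.
  assert (e3 : a 3%nat = c2 / 2 + 3 / 4 * c1 ^ 2) by (unfold c2; field).
  assert (e4 : a 4%nat = c3 / 3 + 5 / 6 * (c1 * c2) + 19 / 36 * c1 ^ 3) by (unfold c3; field).
  assert (e5 : a 5%nat = c4 / 4 + 101 / 288 * c1 ^ 4 + 23 / 24 * (c1 ^ 2 * c2) + 7 / 12 * (c1 * c3) + c2 ^ 2 / 4)
    by (unfold c4; field).
  rewrite (H31_schwarz a c1 c2 c3 c4 e2 e3 e4 e5).
  (* From here on the [c]'s are independent symbols and the coefficients of [f] are expressed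
     through them. *)
  clearbody c1 c2 c3 c4.
  set (P := poly4 0 c1 c2 c3 c4).
  assert (HP : bigO 1 P).
  { apply (bigO_ext 1 (fun z => z * poly4 c1 c2 c3 c4 0 z)).
    - intros z; unfold P, poly4; ring.
    - apply (bigO_mult 1 0 (fun z => z)); [apply bigO_id|apply bigO_poly4]. }
  (* Differentiability at 0 with [eps = 1] suffices: |w(z)| <= (|w'(0)| + 1) |z| near 0. *)
  assert (Hw : bigO 1 w).
  { assert (Hex : exists l : C, cderiv w (RtoC 0) l) by exact (Hwa 0 D0).
    destruct Hex as [l Hl]. rewrite cderiv_eps in Hl. destruct (Hl 1%R Rlt_0_1) as [d [Hd h]].
    exists (Cmod l + 1)%R, d. split; [assert (k := Cmod_ge_0 l); lra|]. split; [exact Hd|].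
    intros z Hz. assert (z0 : z - 0 = z) by ring. specialize (h z). rewrite Hw0, z0 in h. specialize (h Hz).
    replace (w z) with ((w z - 0 - z * l) + z * l) by ring.
    eapply Rle_trans; [apply Cmod_triangle|]. rewrite Cmod_mult. simpl. lra. }
  assert (Hf1o : bigO 1 (fun z => f1 z - 1)).
  { destruct (taylor_disc_shift _ _ Tf1) as [h [Th Eh]].
    apply (bigO_ext_near 1 (fun z => z * h z) _ 1 Rlt_0_1).
    - intros z Hz. rewrite (Eh z Hz). unfold dcoef. simpl. rewrite a1. ring.
    - apply (bigO_mult 1 0 (fun z => z)); [apply bigO_id|eapply taylor_disc_bigO, Th]. }
  (* Expansion to order 4 of both sides, with the truncated logarithm built up from the powers of
     [P]. The vanishing of all five coefficients is exactly the system that defined the [c]'s. *)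
  assert (HJ : bigO 5 (fun z => f1 z * (1 - (P z - P z ^ 2 / 2 + P z ^ 3 / 3 - P z ^ 4 / 4)) - g z)).
  { assert (J1 := jet4_poly4 0 c1 c2 c3 c4). fold P in J1.
    assert (J2 := jet4_mult _ _ _ _ _ _ _ _ _ _ _ _ J1 J1).
    assert (J3 := jet4_mult _ _ _ _ _ _ _ _ _ _ _ _ J2 J1).
    assert (J4 := jet4_mult _ _ _ _ _ _ _ _ _ _ _ _ J3 J1).
    assert (J0 := jet4_poly4 1 0 0 0 0).
    assert (JL := jet4_linear (/ 4) _ _ _ _ _ _ _ _ _ _ _ _ (jet4_linear (- / 3) _ _ _ _ _ _ _ _ _ _ _ _
      (jet4_linear (/ 2) _ _ _ _ _ _ _ _ _ _ _ _ (jet4_linear (-(1)) _ _ _ _ _ _ _ _ _ _ _ _ J0 J1) J2) J3) J4).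
    assert (JF := jet4_linear (-(1)) _ _ _ _ _ _ _ _ _ _ _ _
       (jet4_mult _ _ _ _ _ _ _ _ _ _ _ _ (taylor_disc_jet4 _ _ Tf1) JL) (taylor_disc_jet4 _ _ Tg)).
    unfold dcoef in JF. rewrite a1, e2, e3, e4, e5 in JF. simpl INR in JF.
    rewrite !RtoC_plus in JF.
    unfold jet4 in JF.
    eapply bigO_ext; [|exact JF]. intros z. cbv beta.
    match goal with |- ?X - poly4 ?d0 ?d1 ?d2 ?d3 ?d4 z = _ =>
      replace d0 with (RtoC 0) by ring; replace d1 with (RtoC 0) by ring;
      replace d2 with (RtoC 0) by field;
      replace d3 with (RtoC 0) by field;
      replace d4 with (RtoC 0) by field end.
    unfold poly4. field. }
  assert (HwP := jet4_of_Clog w f1 g P Hw HP Hf1o Hwd E HJ).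
  destruct HwP as [M [d [HM [Hd Hb]]]].
  (* Index 0 falls into the default case, in accordance with [w 0 = 0]. *)
  set (c := fun k : nat => match k with 1%nat => c1 | 2%nat => c2 | 3%nat => c3 | 4%nat => c4 | _ => RtoC 0 end).
  assert (Bs := bessel w c 4 M d Cw (fun z Hz => Rlt_le _ _ (Hwd z (proj2 Hz))) Hd).
  rewrite !sum_Sn, sum_O in Bs. unfold plus in Bs; simpl AbelianMonoid.plus in Bs; cbv beta in Bs.
  apply hankel_bound.
  eapply Rle_trans; [|apply Bs].
  - unfold c. rewrite Cmod_0. apply Req_le. ring.
  - intros z [_ Hz]. replace (tpoly c 4 z) with (P z); [apply Hb, Hz|].
    unfold tpoly. rewrite !sum_Sn, sum_O. change (@plus (NormedModule.AbelianMonoid C_AbsRing C_NormedModule)) with Cplus.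
    unfold P, poly4, c. ring.
Qed.

(** * The extremal function *)

(** Needed because each coefficient of the extremal function depends on all earlier ones. [tab n] is
    a table whose entries are correct below [n], and the hypothesis says that [F n] consults no
    others. *)
Lemma course_of_values_rec (F : nat -> (nat -> R) -> R) :
  (forall n u v, (forall k, (k < n)%nat -> u k = v k) -> F n u = F n v) ->
  exists u : nat -> R, forall n, u n = F n u.
Proof.
  intros HF.
  set (tab := fix tab n : nat -> R :=
    match n with O => fun _ => 0%R | S m => fun k => if Nat.ltb k m then tab m k else F m (tab m) end).
  exists (fun n => F n (tab n)). intros n. apply HF. intros k Hk.
  assert (H : forall m, (k < m)%nat -> tab m k = F k (tab k)).
  { induction m as [|m IH]; intros Hm; [lia|]. simpl.
    destruct (Nat.ltb_spec k m) as [h|h]; [apply IH, h|].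
    replace m with k by lia. reflexivity. }
  apply H, Hk.
Qed.

(* [(1 + z) (1 - log (1 + z)) = 1 - sum_k mcoef k z^k]; the point of the factor [1 + z]
   is that the coefficients become absolutely summable, with sum exactly 1. *)
Definition mcoef (n : nat) : R :=
  match n with O => 0 | S O => 0 | S (S j) => (-1) ^ j / (INR (S j) * INR (S (S j))) end%R.

(** Partial fractions, so that sums of absolute values telescope. *)
Lemma Rabs_mcoef (j : nat) : Rabs (mcoef (S (S j))) = (/ INR (S j) - / INR (S (S j)))%R.
Proof.
  assert (h1 := lt_0_INR (S j) ltac:(lia)). assert (h2 := lt_0_INR (S (S j)) ltac:(lia)).
  assert (h : (0 < INR (S j) * INR (S (S j)))%R) by (apply Rmult_lt_0_compat; assumption).
  unfold mcoef. rewrite Rabs_div by lra. rewrite pow_1_abs, (Rabs_pos_eq (INR (S j) * INR (S (S j)))) by lra.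
  rewrite (S_INR (S j)) in *. field. lra.
Qed.

(** The sum runs through the indices m + 1 down to 1. It telescopes, and the last index contributes
    0 and falls outside the telescoping formula. *)
Lemma sum_Rabs_mcoef_le (m : nat) : (sum_n (fun j => Rabs (mcoef (S m - j))) m <= 1)%R.
Proof.
  assert (H : forall p, (p < m)%nat ->
    (sum_n (fun j => Rabs (mcoef (S m - j))) p <= / INR (m - p) - / INR (S m))%R).
  { induction p as [|p IH]; intros Hp.
    - rewrite sum_O. destruct m as [|m]; [lia|].
      replace (S (S m) - 0)%nat with (S (S m)) by lia. replace (S m - 0)%nat with (S m) by lia.
      rewrite Rabs_mcoef. lra.
    - rewrite sum_Sn. specialize (IH ltac:(lia)).
      replace (S m - S p)%nat with (S (S (m - S p - 1)))%nat by lia. rewrite Rabs_mcoef.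
      replace (S (m - S p - 1)) with (m - S p)%nat by lia.
      replace (S (m - S p)) with (m - p)%nat by lia.
      match goal with |- (plus ?x ?y <= _)%R => change (x + y <= / INR (m - S p) - / INR (S m))%R end. lra. }
  destruct m as [|m].
  - rewrite sum_O. simpl. rewrite Rabs_R0. lra.
  - rewrite sum_Sn. specialize (H m ltac:(lia)).
    replace (S (S m) - S m)%nat with 1%nat by lia. replace (S m - m)%nat with 1%nat in H by lia.
    simpl (mcoef 1). rewrite Rabs_R0.
    match goal with |- (plus ?x ?y <= _)%R => change (x + y <= 1)%R end.
    assert (h := Rinv_0_lt_compat _ (lt_0_INR (S (S m)) ltac:(lia))). simpl (INR 1) in H. rewrite Rinv_1 in H. lra.
Qed.

(** The recursion is the comparison of coefficients of z^(m+1) in (1 + z)(1 - log (1 + z)) (G + 3 z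
    G') = (1 + z) G. If all earlier coefficients are at most 1, its right side is at most 1 + (3m +
    1), which is below 3(m + 1); this closes the induction. *)
Lemma extremal_coef :
  exists g : nat -> R, g 0%nat = 1%R /\
    (forall m, (3 * INR (S m) * g (S m) = g m + sum_n (fun j => mcoef (S m - j) * ((3 * INR j + 1) * g j)) m)%R) /\
    (forall n, (Rabs (g n) <= 1)%R).
Proof.
  destruct (course_of_values_rec (fun n u => match n with O => 1%R | S m =>
    ((u m + sum_n (fun j => mcoef (S m - j) * ((3 * INR j + 1) * u j)) m) / (3 * INR (S m)))%R end)) as [g Hg].
  { intros [|m] u v H; [reflexivity|]. rewrite (H m) by lia. do 2 f_equal.
    apply sum_n_ext_loc. intros k Hk. rewrite (H k) by lia. reflexivity. }
  exists g.
  assert (Hr : forall m, (3 * INR (S m) * g (S m) = g m + sum_n (fun j => mcoef (S m - j) * ((3 * INR j + 1) * g j)) m)%R).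
  { intros m. rewrite (Hg (S m)). field. apply not_0_INR; lia. }
  split; [apply (Hg 0%nat)|]. split; [exact Hr|].
  apply (well_founded_induction lt_wf). intros [|m] IH; [rewrite Hg, Rabs_R1; lra|].
  assert (h0 := pos_INR m).
  assert (h1 := IH m ltac:(lia)).
  assert (h2 : (Rabs (sum_n (fun j => mcoef (S m - j) * ((3 * INR j + 1) * g j)) m) <= 3 * INR m + 1)%R).
  { apply Rle_trans with (sum_n (fun j => (3 * INR m + 1) * Rabs (mcoef (S m - j)))%R m).
    - assert (K : forall p, (p <= m)%nat ->
        (Rabs (sum_n (fun j => mcoef (S m - j) * ((3 * INR j + 1) * g j)) p) <=
         sum_n (fun j => (3 * INR m + 1) * Rabs (mcoef (S m - j))) p)%R).
      2:{ apply K; lia. }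
      assert (T : forall j, (j <= m)%nat -> (Rabs (mcoef (S m - j) * ((3 * INR j + 1) * g j)) <=
         (3 * INR m + 1) * Rabs (mcoef (S m - j)))%R).
      { intros j Hj. rewrite Rabs_mult, Rmult_comm. apply Rmult_le_compat_r; [apply Rabs_pos|].
        assert (j0 := pos_INR j). assert (jm := le_INR _ _ Hj).
        rewrite Rabs_mult, (Rabs_pos_eq (3 * INR j + 1)) by lra.
        assert (hj := IH j ltac:(lia)). assert (hj0 := Rabs_pos (g j)). nra. }
      induction p as [|p IHp]; intros Hp; [rewrite !sum_O; apply T; lia|].
      rewrite !sum_Sn. unfold plus; simpl AbelianMonoid.plus; cbv beta.
      eapply Rle_trans; [apply Rabs_triang|]. apply Rplus_le_compat; [apply IHp; lia|exact (T (S p) Hp)].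
    - assert (k := sum_Rabs_mcoef_le m).
      eapply Rle_trans.
      { apply Req_le. exact (sum_n_mult_l (K := R_Ring) (3 * INR m + 1)%R (fun j => Rabs (mcoef (S m - j))) m). }
      set (s := sum_n (fun j => Rabs (mcoef (S m - j))) m) in *.
      change ((3 * INR m + 1) * s <= 3 * INR m + 1)%R. change (s <= 1)%R in k. clearbody s.
      change R in s. nra. }
  assert (h3 : (Rabs (3 * INR (S m) * g (S m)) <= 3 * INR (S m))%R).
  { rewrite Hr. eapply Rle_trans; [apply Rabs_triang|]. rewrite S_INR. lra. }
  assert (h4 : (0 < 3 * INR (S m))%R) by (rewrite S_INR; lra).
  rewrite Rabs_mult, (Rabs_pos_eq (3 * INR (S m))) in h3 by lra.
  apply Rmult_le_reg_l with (1 := h4). lra.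
Qed.

Lemma taylor_disc_const (c : C) : taylor_disc (fun _ => c) (fun n => match n with O => c | S _ => RtoC 0 end).
Proof.
  intros z _. apply cpseries_cseries, cseries_eps. intros eps He. exists 0%nat. intros n _.
  replace (csum _ n) with c.
  - replace (c - c) with (RtoC 0) by ring. rewrite Cmod_0. exact He.
  - induction n as [|n IH]; [rewrite sum_O; simpl; ring|].
    rewrite sum_Sn, <- IH. change (plus ?x ?y) with (x + y). ring.
Qed.

Lemma mcoef_taylor :
  taylor_disc (fun z => (Clog (1 + z) + z * Clog (1 + z)) + (-(1)) * (z * 1)) (fun n => RtoC (mcoef n)).
Proof.
  assert (H := taylor_disc_plus _ _ _ _ (taylor_disc_plus _ _ _ _ Clog_taylor (taylor_disc_mult_id _ _ Clog_taylor))
    (taylor_disc_scal (-(1)) _ _ (taylor_disc_mult_id _ _ (taylor_disc_const 1)))).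
  eapply taylor_disc_ext; [| |exact H]; [reflexivity|].
  intros [|[|j]]; cbv beta iota.
  - unfold lcoef, mcoef. ring.
  - unfold lcoef, mcoef. replace ((-1) ^ 0 / INR 1)%R with 1%R by (simpl; field). ring.
  - unfold lcoef, mcoef. rewrite Cmult_0_r, Cplus_0_r, <- RtoC_plus. f_equal.
    assert (h1 := lt_0_INR (S j) ltac:(lia)). rewrite (S_INR (S j)). simpl pow. field. lra.
Qed.

(** The partial sum up to [n] of the spread-out series is the partial sum up to [n / 3] of the
    original one at z^3. *)
Lemma taylor_disc_lacunary3 (f : C -> C) (a : nat -> C) :
  taylor_disc f a ->
  taylor_disc (fun z => f (z ^ 3)) (fun n => if Nat.eqb (n mod 3) 0 then a (n / 3)%nat else RtoC 0).
Proof.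
  intros Hf z Hz.
  assert (Hz3 : unit_disc (z ^ 3)).
  { unfold unit_disc in *. rewrite Cmod_pow. assert (h := Cmod_ge_0 z).
    simpl. assert (Cmod z * Cmod z < 1)%R by nra. nra. }
  assert (H := proj1 (cseries_eps _ _) (proj1 (cpseries_cseries _ _ _) (Hf _ Hz3))).
  apply cpseries_cseries, cseries_eps. intros eps He.
  destruct (H eps He) as [N HN]. exists (3 * N)%nat. intros n Hn.
  assert (E : forall n, csum (fun k => (if Nat.eqb (k mod 3) 0 then a (k / 3)%nat else RtoC 0) * z ^ k) n
    = csum (fun k => a k * (z ^ 3) ^ k) (n / 3)).
  { clear. induction n as [|n IH]; [rewrite !sum_O; reflexivity|].
    rewrite sum_Sn, IH. change (plus ?x ?y) with (x + y).
    assert (h1 := Nat.div_mod_eq n 3). assert (h2 := Nat.mod_upper_bound n 3 ltac:(lia)).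
    assert (h3 := Nat.div_mod_eq (S n) 3). assert (h4 := Nat.mod_upper_bound (S n) 3 ltac:(lia)).
    destruct (Nat.eqb_spec (S n mod 3) 0) as [h|h].
    - replace (S n / 3)%nat with (S (n / 3)) by lia. rewrite sum_Sn. change (plus ?x ?y) with (x + y).
      rewrite <- Cpow_mult_r. do 3 f_equal. lia.
    - replace (S n / 3)%nat with (n / 3)%nat by lia. rewrite Cmult_0_l. apply Cplus_0_r. }
  rewrite E. apply HN. apply Nat.div_le_lower_bound; lia.
Qed.

(** The coefficient [g 1] is recorded because it becomes a4 of the extremal function, and with it
    the value of the determinant. *)
Lemma extremal_equation :
  exists (g : nat -> C) (G G1 : C -> C),
    g 0%nat = 1 /\ g 1%nat = RtoC (1 / 3) /\
    taylor_disc G g /\ taylor_disc G1 (dcoef g) /\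
    forall z, unit_disc z -> (G z + 3 * (z * G1 z)) * (1 - Clog (1 + z)) = G z.
Proof.
  destruct extremal_coef as [g [g0 [gr gb]]].
  assert (Ht : tame (fun n => RtoC (g n))).
  { intros r Hr. exists 1%R. intros n. rewrite Cmod_R.
    assert (h : (0 <= r ^ n <= 1)%R).
    { split; [apply pow_le; lra|]. rewrite <- (pow1 n). apply pow_incr; lra. }
    assert (h1 := gb n). assert (h2 := Rabs_pos (g n)). nra. }
  destruct (taylor_disc_intro _ Ht) as [G TG].
  destruct (taylor_disc_deriv _ _ TG) as [G1 [TG1 _]].
  exists (fun n => RtoC (g n)), G, G1.
  split; [rewrite g0; reflexivity|]. split.
  { f_equal. assert (h := gr 0%nat). rewrite sum_O, g0 in h. simpl in h. lra. }
  split; [exact TG|]. split; [exact TG1|].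
  set (D := fun z => G z + 3 * (z * G1 z)).
  assert (TD : taylor_disc D (fun n => RtoC ((3 * INR n + 1) * g n))).
  { eapply taylor_disc_ext; [| |exact (taylor_disc_plus _ _ _ _ TG (taylor_disc_scal 3 _ _ (taylor_disc_mult_id _ _ TG1)))].
    - reflexivity.
    - intros [|n]; cbv beta iota; unfold dcoef.
      + simpl INR. rewrite Cmult_0_r, Cplus_0_r. f_equal. ring.
      + rewrite <- !RtoC_mult, <- RtoC_plus. f_equal. ring. }
  assert (TDM := taylor_disc_mult _ _ _ _ TD mcoef_taylor).
  assert (T1 := taylor_disc_plus _ _ _ _ TG (taylor_disc_mult_id _ _ TG)).
  assert (T2 := taylor_disc_plus _ _ _ _ T1 TDM).
  intros z Hz. fold (D z).
  (* The equation multiplied by 1 + z, in the form in which [gr] is its comparison of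
     coefficients. *)
  assert (E : (G z + z * G z) + D z * (Clog (1 + z) + z * Clog (1 + z) + - (1) * (z * 1)) = D z).
  { eapply cseries_unique; [exact (T2 z Hz)|].
    eapply is_pseries_ext; [|exact (TD z Hz)]. intros n. cbv beta.
    assert (Ec : forall n, csum (fun k => RtoC ((3 * INR k + 1) * g k) * RtoC (mcoef (n - k))) n
      = RtoC (sum_n (fun k => mcoef (n - k) * ((3 * INR k + 1) * g k))%R n)).
    { intros m. assert (K : forall p, csum (fun k => RtoC ((3 * INR k + 1) * g k) * RtoC (mcoef (m - k))) p
        = RtoC (sum_n (fun k => mcoef (m - k) * ((3 * INR k + 1) * g k))%R p)).
      { induction p as [|p IH].
        - rewrite !sum_O, <- RtoC_mult. f_equal. ring.
        - rewrite !sum_Sn, IH, <- RtoC_mult, (Rmult_comm _ (mcoef _)).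
          match goal with |- plus (RtoC ?x) (RtoC ?y) = _ => change (RtoC x + RtoC y = RtoC (x + y)%R) end.
          rewrite RtoC_plus. reflexivity. }
      apply K. }
    rewrite Ec. destruct n as [|m].
    - rewrite sum_O. simpl. rewrite g0, <- !RtoC_plus. f_equal. ring.
    - rewrite sum_Sn, <- !RtoC_plus. f_equal.
      replace (S m - S m)%nat with 0%nat by lia. simpl (mcoef 0).
      match goal with |- _ = (_ + plus ?x ?y)%R => change (plus x y) with (x + y)%R end.
      assert (h := gr m). lra. }
  assert (h1 := unit_disc_1_plus z Hz).
  set (L := Clog (1 + z)) in *. set (d := D z) in *.
  replace (d * (1 - L)) with ((d - d * (L + z * L + - (1) * (z * 1))) / (1 + z)) by (field; exact h1).
  rewrite <- E at 1. field. exact h1.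
Qed.

(** * Absence of zeros and the extremal function *)

Lemma pos_of_derive_ge_scal (y dy : R -> R) (K : R) :
  (forall t, (0 <= t <= 1)%R -> is_derive y t (dy t)) ->
  (forall t, (0 <= t <= 1)%R -> (- K * y t <= dy t)%R) ->
  (0 < y 0)%R -> (0 < y 1)%R.
Proof.
  intros Hd Hk H0.
  (* Gronwall's integrating factor: the hypothesis makes y(t) exp(K t) nondecreasing. *)
  assert (HD : forall t, (0 <= t <= 1)%R ->
    is_derive (fun s => y s * exp (K * s))%R t ((dy t + K * y t) * exp (K * t))%R).
  { intros t Ht.
    assert (he : is_derive (fun s => exp (K * s)) t (K * exp (K * t))%R) by (auto_derive; trivial; ring).
    assert (hm := is_derive_mult _ _ t _ _ (Hd t Ht) he Rmult_comm).
    replace ((dy t + K * y t) * exp (K * t))%R with (plus (mult (dy t) (exp (K * t))) (mult (y t) (K * exp (K * t))%R))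
      by (unfold plus, mult; simpl; ring). exact hm. }
  destruct (MVT_gen (fun s => y s * exp (K * s))%R 0 1 (fun t => (dy t + K * y t) * exp (K * t))%R) as [c [Hc E]].
  - intros t. rewrite Rmin_left, Rmax_right by lra. intros Ht. apply HD. lra.
  - intros t. rewrite Rmin_left, Rmax_right by lra. intros Ht.
    apply continuity_pt_filterlim. apply (ex_derive_continuous (K := R_AbsRing) (V := R_NormedModule) (fun s => y s * exp (K * s))%R t).
    exists ((dy t + K * y t) * exp (K * t))%R. exact (HD t Ht).
  - rewrite Rmin_left, Rmax_right in Hc by lra.
    assert (h1 := Hk c Hc). assert (h2 := exp_pos (K * c)). assert (h3 := exp_pos (K * 1)).
    replace (K * 0)%R with 0%R in E by ring. rewrite exp_0 in E.
    assert (h4 : (0 <= (dy c + K * y c) * exp (K * c))%R) by (apply Rmult_le_pos; lra).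
    assert (h5 : (0 < y 1 * exp (K * 1))%R) by lra.
    apply Rnot_le_lt; intros h6. nra.
Qed.

(** [G] solves the linear equation 3 G' (1 - log (1 + z)) = G log(1 + z)/z, whose coefficients are
    bounded on |z| <= |z0| after division by 1 - log (1 + z). Hence |G|^2 can decay at most
    exponentially along the segment from 0, where it equals 1. *)
Lemma extremal_nonvanishing (g : nat -> C) (G G1 : C -> C) :
  g 0%nat = 1 -> taylor_disc G g -> taylor_disc G1 (dcoef g) -> g 1%nat = RtoC (1 / 3) ->
  (forall z, unit_disc z -> (G z + 3 * (z * G1 z)) * (1 - Clog (1 + z)) = G z) ->
  forall z, unit_disc z -> G z <> 0.
Proof.
  intros g0 TG TG1 g1 E z0 Hz0.
  destruct (taylor_disc_shift _ _ Clog_taylor) as [h [Th Eh]].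
  (* Here a factor z is cancelled, with [h] = log(1 + z)/z. At 0 both sides are read off the
     coefficients, using [g 1 = 1/3]. *)
  assert (El : forall z, unit_disc z -> 3 * G1 z * (1 - Clog (1 + z)) = G z * h z).
  { intros z Hz. destruct (Ceq_dec z 0) as [->|Hn].
    - rewrite (taylor_disc_0 _ _ Clog_taylor), (taylor_disc_0 _ _ TG1), (taylor_disc_0 _ _ TG), (taylor_disc_0 _ _ Th).
      unfold dcoef, lcoef. rewrite g0, g1. replace ((-1) ^ 0 / INR 1)%R with 1%R by (simpl; field).
      rewrite RtoC_div by lra. simpl INR. field.
    - assert (E1 := E z Hz). assert (E2 := Eh z Hz). cbv beta in E2. simpl lcoef in E2.
      rewrite Cplus_0_l in E2.
      replace (G z * h z) with (G z * (z * h z) / z) by (field; exact Hn). rewrite <- E2.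
      replace (3 * G1 z * (1 - Clog (1 + z)))
        with (((G z + 3 * (z * G1 z)) * (1 - Clog (1 + z)) - G z + G z * Clog (1 + z)) / z) by (field; exact Hn).
      rewrite E1. field. exact Hn. }
  destruct (taylor_disc_bounded h _ (Cmod z0) Th (conj (Cmod_ge_0 z0) Hz0)) as [B HB].
  assert (HB0 : (0 <= B)%R).
  { eapply Rle_trans; [apply (Cmod_ge_0 (h z0))|apply HB; lra]. }
  assert (l2 := ln_2_lt_1).
  assert (HG1 : forall z, (Cmod z <= Cmod z0)%R -> (3 * (1 - ln 2) * Cmod (G1 z) <= B * Cmod (G z))%R).
  { intros z Hz. assert (Hzd : unit_disc z) by (unfold unit_disc in *; lra).
    assert (e := f_equal Cmod (El z Hzd)). rewrite !Cmod_mult in e.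
    rewrite (Cmod_R 3), (Rabs_pos_eq 3) in e by lra.
    assert (k1 := Cmod_one_minus_Clog z Hzd). assert (k2 := HB z Hz).
    assert (k3 := Cmod_ge_0 (G1 z)). assert (k4 := Cmod_ge_0 (G z)).
    apply Rle_trans with (Cmod (G z) * Cmod (h z))%R; [rewrite <- e; nra|nra]. }
  (* The derivative of |G(t z0)|^2 is 2 Re (z0 G' conj G), and |G'| <= B / (3 (1 - ln 2)) |G| by
     [HG1]. *)
  set (K := (2 * (Cmod z0 * (B / (3 * (1 - ln 2)))))%R).
  set (y := fun t => (Re (G (RtoC t * z0)%C) ^ 2 + Im (G (RtoC t * z0)%C) ^ 2)%R).
  assert (DG : forall z, unit_disc z -> cderiv G z (G1 z)) by (intros z Hz; eapply taylor_disc_cderiv; eassumption).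
  assert (Hpos : (0 < y 1)%R).
  { apply (pos_of_derive_ge_scal y
      (fun t => 2 * Re (z0 * G1 (RtoC t * z0)%C) * Re (G (RtoC t * z0)%C) + 2 * Im (z0 * G1 (RtoC t * z0)%C) * Im (G (RtoC t * z0)%C))%R K).
    - intros t Ht.
      destruct (cderiv_rderiv G (fun s => RtoC s * z0) t _ _ (DG _ (unit_disc_segment z0 t Hz0 Ht)) (rderiv_segment z0 t)) as [d1 d2].
      assert (p1 := is_derive_pow _ 2 t _ d1). assert (p2 := is_derive_pow _ 2 t _ d2).
      assert (p := is_derive_plus _ _ t _ _ p1 p2).
      match type of p with is_derive _ _ ?l => match goal with |- is_derive _ _ ?m => replace m with (l : R) end end; [exact p|].
      unfold plus; simpl. ring.
    - intros t Ht.
      set (v := G1 (RtoC t * z0)). set (u := G (RtoC t * z0)).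
      assert (hle : (Cmod (RtoC t * z0) <= Cmod z0)%R).
      { rewrite Cmod_mult, Cmod_R, Rabs_pos_eq by lra. assert (k := Cmod_ge_0 z0). nra. }
      assert (k1 := HG1 _ hle). fold v u in k1.
      assert (k2 : (Cmod v <= B / (3 * (1 - ln 2)) * Cmod u)%R).
      { apply Rmult_le_reg_l with (3 * (1 - ln 2))%R; [lra|].
        eapply Rle_trans; [exact k1|]. apply Req_le. field. lra. }
      assert (k3 : (Rabs (Re (z0 * v * Cconj u)) <= Cmod z0 * (B / (3 * (1 - ln 2))) * Cmod u ^ 2)%R).
      { eapply Rle_trans; [apply re_le_Cmod|]. rewrite !Cmod_mult, Cmod_conj.
        replace (Cmod z0 * (B / (3 * (1 - ln 2))) * Cmod u ^ 2)%R
          with (Cmod z0 * (B / (3 * (1 - ln 2)) * Cmod u) * Cmod u)%R by (simpl; ring).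
        apply Rmult_le_compat_r; [apply Cmod_ge_0|]. apply Rmult_le_compat_l; [apply Cmod_ge_0|exact k2]. }
      unfold y. fold u. rewrite <- Cmod2_alt.
      replace (2 * Re (z0 * v) * Re u + 2 * Im (z0 * v) * Im u)%R with (2 * Re (z0 * v * Cconj u))%R
        by (unfold Re, Im; simpl; ring).
      apply Rabs_le_between in k3. unfold K. lra.
    - unfold y. rewrite Cmult_0_l, (taylor_disc_0 _ _ TG), g0. unfold Re, Im; simpl. lra. }
  intros Hc. unfold y in Hpos. rewrite Cmult_1_l, Hc in Hpos. unfold Re, Im in Hpos; simpl in Hpos. lra.
Qed.

Lemma extremal_function :
  exists (f : C -> C) (a : nat -> C),
    S_star_B f /\ taylor_disc f a /\ Cmod (H31 a) = (1 / 9)%R.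
Proof.
  destruct extremal_equation as [g [G [G1 [g0 [g1 [TG [TG1 E]]]]]]].
  assert (NZ := extremal_nonvanishing g G G1 g0 TG TG1 g1 E).
  assert (Tf := taylor_disc_mult_id _ _ (taylor_disc_lacunary3 _ _ TG)).
  match type of Tf with taylor_disc ?f ?a => set (F := f) in *; set (A := a) in * end.
  exists F, A.
  assert (D3 : forall z, unit_disc z -> unit_disc (z ^ 3)).
  { unfold unit_disc; intros z Hz. rewrite Cmod_pow. assert (h := Cmod_ge_0 z).
    simpl. assert (Cmod z * Cmod z < 1)%R by nra. nra. }
  assert (DF : forall z, unit_disc z -> cderiv F z (G (z ^ 3) + 3 * (z ^ 3 * G1 (z ^ 3)))).
  { intros z Hz.
    assert (d1 := cderiv_comp G (fun y => y ^ 3) z _ _ (taylor_disc_cderiv G G1 g _ TG TG1 (D3 z Hz)) (cderiv_pow 2 z)).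
    assert (d2 := cderiv_mult (fun y => y) _ z _ _ (cderiv_id z) d1).
    match type of d2 with is_derive _ _ ?l => match goal with |- is_derive _ _ ?m => replace m with (l : C) end end; [exact d2|].
    simpl INR. rewrite !RtoC_plus. cbv beta. ring. }
  assert (D0 : unit_disc 0) by (unfold unit_disc; rewrite Cmod_0; lra).
  split; [|split; [exact Tf|]].
  - split; [split; [|split]|split].
    + intros z Hz. eexists. apply DF, Hz.
    + unfold F. ring.
    + rewrite (is_C_derive_unique F 0 _ (DF 0 D0)).
      replace (0 ^ 3) with (RtoC 0) by ring. rewrite (taylor_disc_0 _ _ TG), g0. ring.
    + intros z Hz Hn. unfold F. apply Cmult_neq_0; [exact Hn|]. apply NZ, D3, Hz.
    + exists (fun z => z ^ 3). split; [|split; [|split]].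
      * intros z _. eexists. apply (cderiv_pow 2 z).
      * ring.
      * exact D3.
      * intros z Hz. unfold log_quotient. destruct (Ceq_dec z 0) as [->|Hn].
        -- replace (0 ^ 3) with (RtoC 0) by ring. rewrite (taylor_disc_0 _ _ Clog_taylor). unfold lcoef. field.
        -- rewrite (is_C_derive_unique F z _ (DF z Hz)). unfold F.
           assert (e := E _ (D3 z Hz)). assert (hl := one_minus_Clog_neq_0 _ (D3 z Hz)). assert (hg := NZ _ (D3 z Hz)).
           set (d := G (z ^ 3) + 3 * (z ^ 3 * G1 (z ^ 3))) in *. set (L := 1 - Clog (1 + z ^ 3)) in *.
           rewrite <- e at 1. rewrite <- e in hg.
           field. repeat split; try assumption. intros K; apply hg; rewrite K; ring.
  (* Here a2 = a3 = a5 = 0 and a4 = 1/3, so the determinant reduces to -a4^2 = -1/9. *)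
  - rewrite H31_expand. unfold A. simpl. rewrite g1.
    match goal with |- Cmod ?x = _ => replace x with (RtoC (- (1 / 9))) end.
    + rewrite Cmod_R, Rabs_left; lra.
    + rewrite RtoC_opp, !RtoC_div by lra. field.
Qed.

Theorem theorem2p10 :
  (forall (f : C -> C) (a : nat -> C),
     S_star_B f -> taylor_disc f a -> (Cmod (H31 a) <= 1 / 9)%R) /\
  (exists (f : C -> C) (a : nat -> C),
     S_star_B f /\ taylor_disc f a /\ Cmod (H31 a) = (1 / 9)%R).
Proof.
  split; [exact H31_le|exact extremal_function].
Qed.
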